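(* Let $I=(-1,1)$ and let $A_{\mathtt D}$ be the self-adjoint operator in $L^2_{\mathbb{C}}(I)$ given by $-\frac4{\pi^2}\frac{d^2}{dx^2}$ with Dirichlet boundary conditions. Let $C\in L^2(I)$ be even. Then $$C*_{\mathtt p}P_{\mathrm{odd}}=\varphi_1(A_{\mathtt D}),\qquad C*_{\mathtt a}P_{\mathrm{even}}=\varphi_2(A_{\mathtt D}),$$ where $\varphi_1,\varphi_2$ are the bounded functions on $\sigma(A_{\mathtt D})=\{k^2:k\in\mathbb{N}^*\}$ defined by $$\varphi_1(k^2):=\begin{cases}0&\text{if }k\text{ is odd}\\ \langle e^{\mathtt p}_{k/2}|C\rangle&\text{if }k\text{ is even}\end{cases},\qquad \varphi_2(k^2):=\begin{cases}\langle e^{\mathtt a}_{(k-1)/2}|C\rangle&\text{if }k\text{ is odd}\\0&\text{if }k\text{ is even}\end{cases}\qquad(k\in\mathbb{N}^* ).$$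
   Context: $\mathbb{N}^*=\{1,2,\dots\}$; $L^2(I)$ denotes real-valued, $L^2_{\mathbb{C}}(I)$ complex-valued square integrable functions; $\langle g|h\rangle=\int_{-1}^1g^*h$. $e^{\mathtt p}_k(x)=\frac1{\sqrt2}e^{i\pi kx}$ and $e^{\mathtt a}_k(x)=\frac1{\sqrt2}e^{i\pi(k+\frac12)x}$ for $k\in\mathbb{Z}$; each family is a Hilbert basis of $L^2_{\mathbb{C}}(I)$, and $C*_{\mathtt p}u=\sum_{k\in\mathbb{Z}}\langle e_k^{\mathtt p}|C\rangle\langle e_k^{\mathtt p}|u\rangle e_k^{\mathtt p}$, $C*_{\mathtt a}u=\sum_{k\in\mathbb{Z}}\langle e_k^{\mathtt a}|C\rangle\langle e_k^{\mathtt a}|u\rangle e_k^{\mathtt a}$. $P_{\mathrm{even}}h(x)=\frac12(h(x)+h(-x))$, $P_{\mathrm{odd}}h(x)=\frac12(h(x)-h(-x))$; $C*_{\mathtt p}P_{\mathrm{odd}}$ is the operator $h\mapsto C*_{\mathtt p}(P_{\mathrm{odd}}h)$, similarly $C*_{\mathtt a}P_{\mathrm{even}}$. The eigenfunctions of $A_{\mathtt D}$ are $e_k(x)=\sin(\frac{k\pi}2(x+1))$ ($k\in\mathbb{N}^*$) with simple eigenvalues $k^2$, forming a Hilbert basis, and for a bounded function $\varphi$ on $\sigma(A_{\mathtt D})$, $\varphi(A_{\mathtt D})u=\sum_{k\in\mathbb{N}^*}\varphi(k^2)\langle e_k|u\rangle e_k$. *)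

(* Defs.v *)
From HB Require Import structures.
From mathcomp Require Import all_boot all_order all_algebra finmap.
From mathcomp Require Import all_classical all_reals all_analysis.
From mathcomp Require Import complex.

Set Implicit Arguments.
Unset Strict Implicit.
Unset Printing Implicit Defensive.

Import Order.TTheory GRing.Theory Num.Theory.
Import numFieldNormedType.Exports.

Local Open Scope classical_set_scope.
Local Open Scope ring_scope.
Local Open Scope complex_scope.

(* Elements of L^2_C(I) are represented by functions R -> R[i], of which only
   the restriction to Iset = (-1, 1), up to a.e. equality, matters. *)
Section L2.
Context {R : realType}.
Implicit Types (f g h u v w : R -> R[i]).

Definition Iset : set R := `]-1, 1[.

Definition ae_eqI f g : Prop :=
  {ae @lebesgue_measure R, forall x, Iset x -> f x = g x}.

Definition cintegral (D : set R) f : R[i] :=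
  (\int[@lebesgue_measure R]_(x in D) complex.Re (f x))
  +i* (\int[@lebesgue_measure R]_(x in D) complex.Im (f x)).

Definition L2sqnorm f : \bar R :=
  (\int[@lebesgue_measure R]_(x in Iset) (Normc.normc (f x) ^+ 2)%:E)%E.

Definition L2 f : Prop :=
  [/\ measurable_fun Iset (fun x => complex.Re (f x)),
      measurable_fun Iset (fun x => complex.Im (f x)) &
      (L2sqnorm f < +oo)%E].

Definition inner g h : R[i] := cintegral Iset (fun x => (g x)^* * h x).

(* s is the sum of the family f in L^2_C(I): the finite partial sums converge
   to s in norm along the directed set of finite subsets of J, so that no
   ordering of J is involved. *)
Definition has_L2sum (J : choiceType) (f : J -> R -> R[i]) (s : R -> R[i]) :
    Prop :=
  L2 s /\
  forall eps : R, 0 < eps ->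
  exists A : {fset J}, forall B : {fset J}, (A `<=` B)%fset ->
    (L2sqnorm (fun x => s x - \sum_(j <- B) f j x)%R < eps%:E)%E.

Definition hilbert_basis (J : choiceType) (e : J -> R -> R[i]) : Prop :=
  [/\ forall j, L2 (e j),
      forall j k, inner (e j) (e k) = (j == k)%:R &
      forall u, L2 u -> (forall j, inner (e j) u = 0) ->
        ae_eqI u (fun=> 0)].

(* An operator in L^2_C(I) is given by its graph: T u v means that u lies in
   the domain of T and T u = v almost everywhere. *)
Definition operator := (R -> R[i]) -> (R -> R[i]) -> Prop.

(* S and T are both defined on the whole of L^2_C(I), and they coincide. *)
Definition op_eq (S T : operator) : Prop :=
  forall u, L2 u -> (exists v, S u v) /\ (forall v, S u v <-> T u v).

Definition expi (t : R) : R[i] := cos t +i* sin t.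

Definition ep (k : int) (x : R) : R[i] :=
  ((Num.sqrt 2)^-1)%:C * expi (pi * k%:~R * x).

Definition ea (k : int) (x : R) : R[i] :=
  ((Num.sqrt 2)^-1)%:C * expi (pi * (k%:~R + 2^-1) * x).

Definition conv_in (e : int -> R -> R[i]) (g : R -> R[i]) : operator :=
  fun u v => has_L2sum (fun k x => inner (e k) g * inner (e k) u * e k x) v.

Definition conv_p := conv_in ep.
Definition conv_a := conv_in ea.

Definition P_even h : R -> R[i] := fun x => 2^-1 * (h x + h (- x)).
Definition P_odd h : R -> R[i] := fun x => 2^-1 * (h x - h (- x)).

(* F is absolutely continuous on [-1, 1] with derivative f almost everywhere
   (for f integrable on Iset). *)
Definition AC_with_derivative (F f : R -> R[i]) : Prop :=
  forall x, -1 <= x <= 1 -> F x = F (-1) + cintegral `[-1, x] f.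

(* Graph of A_D = - (4 / pi^2) d^2/dx^2 on the domain H^2(I) `&` H^1_0(I):
   u has a representative w on [-1, 1] that vanishes at both end points and
   is C^1 with absolutely continuous derivative w1, and w1' = w2 is in L^2. *)
Definition A_D : operator := fun u v =>
  L2 u /\ L2 v /\
  exists w w1 w2 : R -> R[i],
    [/\ ae_eqI u w, w (-1) = 0 /\ w 1 = 0,
        AC_with_derivative w w1,
        L2 w2 /\ AC_with_derivative w1 w2 &
        ae_eqI v (fun x => - (4 / pi ^+ 2)%:C * w2 x)].

Definition eigenbasis (J : choiceType) (A : operator)
    (lambda : J -> R) (e : J -> R -> R[i]) : Prop :=
  hilbert_basis e /\ forall j, A (e j) (fun x => (lambda j)%:C * e j x).

(* phi(A) for an operator A that is diagonal in the Hilbert basis e with real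
   eigenvalues lambda; only the values of phi at the eigenvalues matter. *)
Definition functional_calculus (J : choiceType) (A : operator)
    (lambda : J -> R) (e : J -> R -> R[i]) (phi : R -> R[i]) : operator :=
  fun u v => eigenbasis A lambda e /\
    has_L2sum (fun j x => phi (lambda j) * inner (e j) u * e j x) v.

Definition eD (k : nat) (x : R) : R[i] := (sin (k%:R * pi / 2 * (x + 1)))%:C.

(* phi(A_D), from the eigenfunctions eD k with eigenvalues k^2 for k >= 1;
   the index j : nat below stands for k = j + 1. *)
Definition phi_A_D (phi : R -> R[i]) : operator :=
  functional_calculus A_D (fun j : nat => j.+1%:R ^+ 2) (fun j => eD j.+1) phi.

Definition sigma_A_D : set R := [set k%:R ^+ 2 | k in [set k : nat | (0 < k)%N]].

Definition bounded_on (D : set R) (phi : R -> R[i]) : Prop :=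
  exists M : R, forall l, D l -> Normc.normc (phi l) <= M.

End L2.

(* Main.v *)
(* The partial sums of the convolution series over the frequencies k and -k
   fold into sine series, because C is even and the projected function is odd,
   resp. even: the sums of the two terms are multiples of the eigenfunctions of
   A_D.  By Bessel's inequality the coefficients of C and of u are square
   summable, so their products are absolutely summable; both series therefore
   converge uniformly, unconditionally and to the same limit.

   That the functions eD k are total is shown by noting that a function f
   orthogonal to all sin(k theta) makes f sin(theta) orthogonal to all
   polynomials in cos(theta).  Polynomials approximating step functions then
   show that the integral of f sin(theta) over every half line vanishes, whence
   f = 0 almost everywhere by Lebesgue differentiation. *)

(* An operator is a graph whose values are determined only up to null sets, so equality of operators
   means that each sum of one series is also a sum of the other. It suffices to exhibit one function
   to which both series sum: two sums of the same series are at distance 0, so every other sum can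
   be carried across.

   The constants match as follows. A term of the convolution contains three factors 1/sqrt 2. One
   stays inside the coefficient of C, which is the value of phi; the other two give 1/2, which is
   undone when the terms of frequencies r and -r are added. The shift from x to x + 1 in the
   eigenfunctions produces a sign (-1)^m; it occurs once in the coefficient of u and once in the
   eigenfunction, and cancels. The eigenfunctions have norm 1 as they stand because I has length
   2. *)
Require Import Defs.
From HB Require Import structures.
From mathcomp Require Import all_boot all_order all_algebra finmap.
From mathcomp Require Import all_classical all_reals all_analysis.
From mathcomp Require Import complex.
From mathcomp Require Import measurable_realfun.
From mathcomp Require Import ring lra.
Set Implicit Arguments.
Unset Strict Implicit.
Unset Printing Implicit Defensive.
Import Order.TTheory GRing.Theory Num.Theory.
Import numFieldNormedType.Exports.
Local Open Scope classical_set_scope.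
Local Open Scope ring_scope.
Local Open Scope complex_scope.

(** * Integrals over (-1, 1) *)

Section IntegralOnI.
Context {R : realType}.
Local Notation mu := (@lebesgue_measure R).
Local Notation I := (@Iset R).
Implicit Types f g h : R -> R.

Definition integrableI f := mu.-integrable I (EFin \o f).

Definition intI f : R := \int[mu]_(x in I) f x.

Lemma measurable_I : measurable (I : set (measurableTypeR R)).
Proof. exact: measurable_itv. Qed.

Lemma lebesgue_measure_I : mu I = 2%:E.
Proof.
rewrite /Iset lebesgue_measure_itv /= lte_fin ifT; last by lra.
by rewrite -EFinB; congr EFin; lra.
Qed.

Lemma integrableI_meas f : integrableI f -> measurable_fun I f.
Proof. by move=> /integrableP[/measurable_EFinP]. Qed.

Lemma eq_integrableI f g : (forall x, f x = g x) -> integrableI f -> integrableI g.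
Proof. by move=> fg; rewrite (_ : f = g)//; exact/funext. Qed.

Lemma eq_intI f g : (forall x, f x = g x) -> intI f = intI g.
Proof. by move=> fg; rewrite (_ : f = g)//; exact/funext. Qed.

Lemma le_integrableI f g : measurable_fun I f -> integrableI g ->
  (forall x, `|f x| <= g x) -> integrableI f.
Proof.
move=> mf ig fg; apply: le_integrable ig; first exact: measurable_I.
- exact/measurable_EFinP.
- by move=> x _ /=; rewrite lee_fin (le_trans (fg x))// ler_norm.
Qed.

Lemma integrableI_bounded f (M : R) : measurable_fun I f ->
  (forall x, `|f x| <= M) -> integrableI f.
Proof.
move=> mf fM; apply: (@le_integrableI _ (cst M)) => //.
have I_fin : (mu I < +oo)%E by rewrite lebesgue_measure_I ltry.
apply: measurable_bounded_integrable; first exact: measurable_I.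
- exact: I_fin.
- exact: measurable_cst.
- exact: bounded_cst.
Qed.

Lemma integrableID f g : integrableI f -> integrableI g ->
  integrableI (fun x => f x + g x).
Proof. by move=> fi gi; exact: (integrableD measurable_I fi gi). Qed.

Lemma integrableIB f g : integrableI f -> integrableI g ->
  integrableI (fun x => f x - g x).
Proof. by move=> fi gi; exact: (integrableB measurable_I fi gi). Qed.

Lemma integrableIZ a f : integrableI f -> integrableI (fun x => a * f x).
Proof. by move=> fi; exact: (integrableZl measurable_I a fi). Qed.

Lemma integrableI_norm f : integrableI f -> integrableI (fun x => `|f x|).
Proof. by move=> fi; exact: (integrable_norm fi). Qed.

Lemma integrableI_sum (J : Type) (s : seq J) (F : J -> R -> R) :
  (forall j, integrableI (F j)) -> integrableI (fun x => \sum_(j <- s) F j x).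
Proof.
move=> Fi; elim: s => [|j s ih].
  apply: (@eq_integrableI (cst 0)) => [x|]; first by rewrite big_nil.
  by apply: (@integrableI_bounded _ 0) => [|x]; rewrite ?normr0.
by apply: (eq_integrableI _ (integrableID (Fi j) ih)) => x; rewrite big_cons.
Qed.

Lemma integrableIM f g (M : R) : measurable_fun I f ->
  (forall x, `|f x| <= M) -> integrableI g -> integrableI (fun x => f x * g x).
Proof.
move=> mf fM gi.
apply: (@le_integrableI _ (fun x => M * `|g x|)).
- by apply: measurable_funM => //; exact: integrableI_meas.
- exact/integrableIZ/integrableI_norm.
- by move=> x; rewrite normrM ler_wpM2r.
Qed.

Lemma intID f g : integrableI f -> integrableI g ->
  intI (fun x => f x + g x) = intI f + intI g.
Proof. by move=> fi gi; rewrite /intI RintegralD//; exact: measurable_I. Qed.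

Lemma intIB f g : integrableI f -> integrableI g ->
  intI (fun x => f x - g x) = intI f - intI g.
Proof. by move=> fi gi; rewrite /intI RintegralB//; exact: measurable_I. Qed.

Lemma intIZ a f : integrableI f -> intI (fun x => a * f x) = a * intI f.
Proof. by move=> fi; rewrite /intI RintegralZl//; exact: measurable_I. Qed.

Lemma intI0 : intI (fun=> 0) = 0.
Proof. by rewrite /intI Rintegral_cst ?mul0r//; exact: measurable_I. Qed.

Lemma intI_sum (J : Type) (s : seq J) (F : J -> R -> R) :
  (forall j, integrableI (F j)) ->
  intI (fun x => \sum_(j <- s) F j x) = \sum_(j <- s) intI (F j).
Proof.
move=> Fi; elim: s => [|j s ih].
  by rewrite big_nil -[RHS]intI0; apply: eq_intI => x; rewrite big_nil.
rewrite big_cons -ih -intID//; last exact: integrableI_sum.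
by apply: eq_intI => x; rewrite big_cons.
Qed.

Lemma intI_ge0 f : (forall x, 0 <= f x) -> 0 <= intI f.
Proof. by move=> f0; apply: Rintegral_ge0. Qed.

Lemma integralI_fin f : integrableI f ->
  (\int[mu]_(x in I) (f x)%:E)%E = (intI f)%:E.
Proof.
move=> fi; rewrite /intI /Rintegral fineK//.
exact: (integrable_fin_num measurable_I fi).
Qed.

Lemma continuous_measI f : continuous f -> measurable_fun I f.
Proof. by move=> cf; apply: measurable_funTS; exact: continuous_measurable_fun. Qed.

Lemma opp_I x : I (- x) <-> I x.
Proof. by rewrite /Iset /= !in_itv/=; split => /andP[? ?]; lra. Qed.

Lemma ge0_integralI_opp (f : R -> R) : measurable_fun I f ->
  (forall x, 0 <= f x) ->
  (\int[mu]_(x in I) (f (- x))%:E = \int[mu]_(x in I) (f x)%:E)%E.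
Proof.
(* The change of variables is a pushforward along negation of the whole line, so f is first extended
   by zero to a function measurable everywhere. *)
move=> mf f0; pose g := f \_ I.
have mg : measurable_fun setT g.
  by apply/(measurable_restrictT _ measurable_I).
transitivity (\int[mu]_(x in I) (g (- x))%:E)%E.
  apply: eq_integral => x; rewrite inE => Ix.
  by rewrite /g patchE mem_set//; exact/opp_I.
transitivity (\int[mu]_(x in I) (g x)%:E)%E; last first.
  by apply: eq_integral => x xI; rewrite /g patchE xI.
rewrite {1}(_ : I = (-%R : _ -> measurableTypeR R) @^-1` I); last first.
  by apply/seteqP; split => x /= Ix; exact/opp_I.
rewrite -(@ge0_integral_pushforward _ _ (measurableTypeR R) (measurableTypeR R)
  R _ _ _ _ (EFin \o g))//=.
- apply: eq_measure_integral => A mA _; exact: (lebesgue_measureN mA).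
- exact: measurable_I.
- exact/measurable_EFinP/measurable_funTS.
- by move=> x _; rewrite lee_fin /g patchE; case: ifP.
Qed.

Lemma measurable_opp_I f : measurable_fun I f -> measurable_fun I (fun x => f (- x)).
Proof.
move=> mf.
have -> : (fun x => f (- x)) = f \o -%R by [].
apply: (@measurable_comp _ _ _ _ _ _ I) => //.
- exact: measurable_I.
- by move=> _ [x Ix <-]; exact/opp_I.
Qed.

Lemma integrableI_opp f : integrableI f -> integrableI (fun x => f (- x)).
Proof.
move=> fi; have mf := integrableI_meas fi.
apply/integrableP; split.
  by apply/measurable_EFinP; exact: measurable_opp_I.
have /integrableP[_] := fi; apply: le_lt_trans.
rewrite -(@ge0_integralI_opp (fun x => `|f x|))//.
exact: measurableT_comp.
Qed.

Lemma intI_opp f : integrableI f -> intI (fun x => f (- x)) = intI f.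
Proof.
move=> fi; have mf := integrableI_meas fi.
have pi' := integrable_funrpos measurable_I fi.
have ni' := integrable_funrneg measurable_I fi.
have pE : intI (fun x => f^\+ (- x)) = intI (f^\+).
  rewrite /intI /Rintegral ge0_integralI_opp//.
  exact: measurable_funrpos.
have nE : intI (fun x => f^\- (- x)) = intI (f^\-).
  rewrite /intI /Rintegral ge0_integralI_opp//.
  exact: measurable_funrneg.
have fE x : f x = f^\+ x - f^\- x by rewrite -{1}(funrposBneg f).
rewrite (eq_intI (fun x => fE (- x))) (eq_intI fE).
rewrite intIB; [|exact: integrableI_opp..].
by rewrite intIB// pE nE.
Qed.

End IntegralOnI.

(** * Sines and cosines on (-1, 1) *)

Section Trig.
Context {R : realType}.
Local Notation mu := (@lebesgue_measure R).
Local Notation I := (@Iset R).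
Implicit Types (x y t : R) (f F : R -> R).

Lemma is_derive_continuous F f : (forall x, is_derive x 1 F (f x)) -> continuous F.
Proof.
move=> dF x; apply: differentiable_continuous; apply/derivable1_diffP.
by apply: ex_derive; exact: dF.
Qed.

Lemma Rintegral_FTC F f y : (forall x, is_derive x 1 F (f x)) -> continuous f ->
  -1 <= y -> \int[mu]_(x in `[-1, y]) f x = F y - F (-1).
Proof.
move=> dF cf; rewrite le_eqVlt => /predU1P[<-|y1].
  by rewrite set_itv1 Rintegral_set1 subrr.
have cF := is_derive_continuous dF.
rewrite /Rintegral (@continuous_FTC2 _ f F)//.
- exact/continuous_subspaceT.
- split.
  + by move=> x _; apply: ex_derive; exact: dF.
  + apply: cvg_at_right_filter; exact: cF.
  + apply: cvg_at_left_filter; exact: cF.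
- by move=> x _; rewrite derive1E; apply: derive_val.
Qed.

Lemma intI_FTC F f : (forall x, is_derive x 1 F (f x)) -> continuous f ->
  intI f = F 1 - F (-1).
Proof.
move=> dF cf; rewrite -(Rintegral_FTC dF cf); last by lra.
have fi : mu.-integrable `[-1, 1] (EFin \o f).
  apply: continuous_compact_integrable; first exact: segment_compact.
  exact/continuous_subspaceT.
rewrite /intI /Iset Rintegral_itv_bndo_bndc; last first.
  by apply: integrableS fi => //; exact: subset_itv_oo_cc.
rewrite Rintegral_itv_obnd_cbnd//.
by apply: integrableS fi => //; exact: subset_itv_oc_cc.
Qed.

(** With theta = pi / 2 * (x + 1), which maps I onto (0, pi), [sinI k] and [cosI k] are sin(k theta)
    and cos(k theta). *)
Definition sinI (k : nat) x := sin (k%:R * pi / 2 * (x + 1)).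
Definition cosI (k : nat) x := cos (k%:R * pi / 2 * (x + 1)).

Lemma is_derive_sin_affine a x :
  is_derive x 1 (fun y => sin (a * (y + 1))) (a * cos (a * (x + 1))).
Proof.
have d1 : is_derive x 1 (fun y => a * (y + 1)) a.
  by apply: is_derive_eq; rewrite /GRing.scale/= addr0 mulr1.
by rewrite mulrC; exact: (is_derive1_comp (is_derive_sin _) d1).
Qed.

Lemma is_derive_cos_affine a x :
  is_derive x 1 (fun y => cos (a * (y + 1))) (- a * sin (a * (x + 1))).
Proof.
have d1 : is_derive x 1 (fun y => a * (y + 1)) a.
  by apply: is_derive_eq; rewrite /GRing.scale/= addr0 mulr1.
by rewrite mulNr mulrC -mulNr; exact: (is_derive1_comp (is_derive_cos _) d1).
Qed.

Lemma continuous_sin_affine a : continuous (fun y : R => sin (a * (y + 1))).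
Proof. exact: is_derive_continuous (is_derive_sin_affine a). Qed.

Lemma continuous_cos_affine a : continuous (fun y : R => cos (a * (y + 1))).
Proof. exact: is_derive_continuous (is_derive_cos_affine a). Qed.

Lemma sin_natpi (n : nat) : sin (n%:R * pi) = 0 :> R.
Proof.
elim: n => [|n ih]; first by rewrite mul0r sin0.
by rewrite -natr1 mulrDl mul1r sinDpi ih oppr0.
Qed.

Lemma cos_natpi (n : nat) : cos (n%:R * pi) = (-1) ^+ n :> R.
Proof.
elim: n => [|n ih]; first by rewrite mul0r cos0.
by rewrite -natr1 mulrDl mul1r cosDpi ih exprS mulN1r.
Qed.

Lemma intI_cosI (n : nat) : intI (cosI n) = if n == 0%N then 2 else 0.
Proof.
case: eqP => [->|/eqP n0].
  rewrite (@eq_intI _ _ (cst 1)) => [|x]; last by rewrite /cosI !mul0r cos0.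
  rewrite /intI (Rintegral_cst mu measurable_I) mul1r.
  exact: (congr1 fine lebesgue_measure_I).
pose a : R := n%:R * pi / 2.
have a0 : a != 0 by rewrite gt_eqF// /a divr_gt0// mulr_gt0// ?pi_gt0// ltr0n lt0n.
have dF x : is_derive x 1 (fun y => a^-1 * sin (a * (y + 1))) (cosI n x).
  have dx := is_derive_sin_affine a x.
  by apply: is_derive_eq; rewrite /GRing.scale/= mulrA mulVf// mul1r.
rewrite (intI_FTC dF (@continuous_cos_affine a)).
rewrite addNr mulr0 sin0 mulr0 subr0.
have -> : a * (1 + 1) = n%:R * pi by rewrite /a; lra.
by rewrite sin_natpi mulr0.
Qed.

Lemma sinI_max k x : `|sinI k x| <= 1. Proof. exact: sin_max. Qed.
Lemma cosI_max k x : `|cosI k x| <= 1. Proof. exact: cos_max. Qed.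

Lemma measurable_sinI k : measurable_fun I (sinI k).
Proof. exact: (continuous_measI (@continuous_sin_affine (k%:R * pi / 2))). Qed.

Lemma measurable_cosI k : measurable_fun I (cosI k).
Proof. exact: (continuous_measI (@continuous_cos_affine (k%:R * pi / 2))). Qed.

Lemma integrableI_cosI k : integrableI (cosI k).
Proof. exact: (integrableI_bounded (measurable_cosI k) (cosI_max k)). Qed.

Lemma cosI_subn j k x : (k <= j)%N ->
  cosI (j - k) x = cos (j%:R * pi / 2 * (x + 1) - k%:R * pi / 2 * (x + 1)).
Proof. by move=> kj; rewrite /cosI natrB//; congr cos; lra. Qed.

Lemma cosI_addn j k x :
  cosI (j + k) x = cos (j%:R * pi / 2 * (x + 1) + k%:R * pi / 2 * (x + 1)).
Proof. by rewrite /cosI natrD; congr cos; lra. Qed.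

Lemma sinI_mul j k x : (k <= j)%N ->
  sinI j x * sinI k x = 2^-1 * (cosI (j - k) x - cosI (j + k) x).
Proof.
by move=> kj; rewrite cosI_subn// cosI_addn cosB cosD -/(sinI j x) -/(sinI k x); lra.
Qed.

Lemma cosI_mul j k x : (k <= j)%N ->
  cosI j x * cosI k x = 2^-1 * (cosI (j - k) x + cosI (j + k) x).
Proof.
by move=> kj; rewrite cosI_subn// cosI_addn cosB cosD -/(cosI j x) -/(cosI k x); lra.
Qed.

(** Product-to-sum leaves only the constant mode [cosI 0], present when j = k; its integral 2
    cancels the factor 1/2. Ordering j and k first makes the natural subtraction j - k exact. *)
Lemma intI_sinI_mul j k : (0 < j)%N -> (0 < k)%N ->
  intI (fun x => sinI j x * sinI k x) = (j == k)%:R.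
Proof.
wlog kj : j k / (k <= j)%N.
  move=> H j0 k0; have [kj|/ltnW jk] := leqP k j; first exact: H.
  by rewrite eq_sym -H//; apply: eq_intI => x; rewrite mulrC.
move=> j0 k0; rewrite (eq_intI (fun x => sinI_mul x kj)).
rewrite intIZ; last by apply: integrableIB; exact: integrableI_cosI.
rewrite intIB; [|exact: integrableI_cosI..].
rewrite !intI_cosI addn_eq0 (gtn_eqF j0)/= subr0 subn_eq0.
by rewrite eqn_leq kj andbT; case: ifP; rewrite ?mulr0// mulVf.
Qed.

Lemma intI_cosI_mul j k : (0 < j)%N -> (0 < k)%N ->
  intI (fun x => cosI j x * cosI k x) = (j == k)%:R.
Proof.
wlog kj : j k / (k <= j)%N.
  move=> H j0 k0; have [kj|/ltnW jk] := leqP k j; first exact: H.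
  by rewrite eq_sym -H//; apply: eq_intI => x; rewrite mulrC.
move=> j0 k0; rewrite (eq_intI (fun x => cosI_mul x kj)).
rewrite intIZ; last by apply: integrableID; exact: integrableI_cosI.
rewrite intID; [|exact: integrableI_cosI..].
rewrite !intI_cosI addn_eq0 (gtn_eqF j0)/= addr0 subn_eq0.
by rewrite eqn_leq kj andbT; case: ifP; rewrite ?mulr0// mulVf.
Qed.

End Trig.

(** * Bessel's inequality *)

Section SquareIntegrable.
Context {R : realType}.
Local Notation I := (@Iset R).
Implicit Types f g h : R -> R.

Definition sqI f := measurable_fun I f /\ integrableI (fun x => f x ^+ 2).

Lemma sqI_bounded f (M : R) : measurable_fun I f -> (forall x, `|f x| <= M) ->
  sqI f.
Proof.
move=> mf fM; split => //; apply: (@integrableI_bounded _ _ (M ^+ 2)).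
  by apply: measurable_funX.
by move=> x; rewrite normrX lerXn2r ?nnegrE// (le_trans _ (fM x)).
Qed.

(** I has finite measure and |f| <= 1 + f^2. *)
Lemma integrableI_sq f : sqI f -> integrableI f.
Proof.
move=> [mf f2]; apply: (@le_integrableI _ _ (fun x => 1 + f x ^+ 2)) => //.
  apply: integrableID => //.
  by apply: (@integrableI_bounded _ _ 1) => // x; rewrite normr1.
by move=> x; rewrite ler_norml; apply/andP; split; nra.
Qed.

Lemma integrableI_sqM f g : sqI f -> sqI g -> integrableI (fun x => f x * g x).
Proof.
move=> [mf f2] [mg g2].
apply: (@le_integrableI _ _ (fun x => f x ^+ 2 + g x ^+ 2)).
- exact: measurable_funM.
- exact: integrableID.
- by move=> x; rewrite ler_norml; apply/andP; split; nra.
Qed.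

Lemma sqIB f g : sqI f -> sqI g -> sqI (fun x => f x - g x).
Proof.
move=> sf sg; have [mf f2] := sf; have [mg g2] := sg.
split; first exact: measurable_funB.
apply: (@eq_integrableI _ (fun x => f x ^+ 2 + g x ^+ 2 - 2 * (f x * g x))).
  by move=> x; ring.
apply: integrableIB; first exact: integrableID.
exact/integrableIZ/integrableI_sqM.
Qed.

Lemma sqIZ a f : sqI f -> sqI (fun x => a * f x).
Proof.
move=> [mf f2]; split; first exact: measurable_funM.
apply: (eq_integrableI _ (integrableIZ (a ^+ 2) f2)) => x; ring.
Qed.

Lemma Bessel (e : nat -> R -> R) f n : (forall j, sqI (e j)) ->
  (forall j k, intI (fun x => e j x * e k x) = (j == k)%:R) -> sqI f ->
  \sum_(j < n) intI (fun x => e j x * f x) ^+ 2 <= intI (fun x => f x ^+ 2).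
Proof.
move=> se oe sf; pose c j := intI (fun x => e j x * f x).
(* h is f minus its projections on the first n functions. Orthonormality leaves the later
   coefficients unchanged, and each projection removes exactly [c j ^+ 2] from the squared norm,
   which stays nonnegative. *)
suff [h [sh hj hh]] : exists h, [/\ sqI h,
    forall j, (n <= j)%N -> intI (fun x => e j x * h x) = c j &
    intI (fun x => h x ^+ 2) =
    intI (fun x => f x ^+ 2) - \sum_(j < n) c j ^+ 2].
  by rewrite -subr_ge0 -hh; apply: intI_ge0 => x; exact: sqr_ge0.
elim: n => [|n [h [sh hj hh]]].
  by exists f; split => //; rewrite big_ord0 subr0.
exists (fun x => h x - c n * e n x); split.
- exact/sqIB/sqIZ.
- move=> j nj; rewrite (@eq_intI _ _ (fun x => e j x * h x -
      c n * (e j x * e n x))); last by move=> x; ring.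
  rewrite intIB; [|exact: integrableI_sqM|exact/integrableIZ/integrableI_sqM].
  rewrite intIZ; last exact: integrableI_sqM.
  by rewrite oe gtn_eqF// mulr0 subr0 hj// ltnW.
- rewrite big_ord_recr/= opprD addrA -hh.
  rewrite (@eq_intI _ _ (fun x => h x ^+ 2 - 2 * c n * (e n x * h x) +
      c n ^+ 2 * (e n x * e n x))); last by move=> x; ring.
  rewrite intID; first last.
  + exact/integrableIZ/integrableI_sqM.
  + by apply: integrableIB; [exact: sh.2|exact/integrableIZ/integrableI_sqM].
  rewrite intIB; [|exact: sh.2|exact/integrableIZ/integrableI_sqM].
  rewrite !intIZ; [|exact: integrableI_sqM..].
  by rewrite oe eqxx hj//=; ring.
Qed.

Lemma sqI_sinI k : sqI (sinI k).
Proof. exact: (sqI_bounded (@measurable_sinI R k) (@sinI_max R k)). Qed.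

Lemma sqI_cosI k : sqI (cosI k).
Proof. exact: (sqI_bounded (@measurable_cosI R k) (@cosI_max R k)). Qed.

Lemma Bessel_sinI f n : sqI f ->
  \sum_(j < n) intI (fun x => sinI j.+1 x * f x) ^+ 2 <= intI (fun x => f x ^+ 2).
Proof.
move=> sf; apply: (Bessel (e := fun j => sinI j.+1)) => // [j|j k].
  exact: sqI_sinI.
by rewrite intI_sinI_mul.
Qed.

(** The index starts at 1 because [cosI 0] has squared norm 2. This bounds the coefficients of C in
    the periodic case. *)
Lemma Bessel_cosI f n : sqI f ->
  \sum_(j < n) intI (fun x => cosI j.+1 x * f x) ^+ 2 <= intI (fun x => f x ^+ 2).
Proof.
move=> sf; apply: (Bessel (e := fun j => cosI j.+1)) => // [j|j k].
  exact: sqI_cosI.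
by rewrite intI_cosI_mul.
Qed.

End SquareIntegrable.

(** * Totality of the sines *)

Section StepPolynomials.
Context {R : realType}.
Local Notation mu := (@lebesgue_measure R).
Local Notation I := (@Iset R).
Implicit Types (f h : R -> R) (x y t : R).

Lemma bernoulli_ge (m : nat) t : 0 <= t -> 1 + m%:R * t <= (1 + t) ^+ m.
Proof.
move=> t0; elim: m => [|m ih]; first by rewrite mul0r addr0 expr0.
rewrite exprS -natr1; apply: (@le_trans _ _ ((1 + t) * (1 + m%:R * t))).
  have m0 : 0 <= m%:R :> R by []. nra.
by rewrite ler_wpM2l// addr_ge0.
Qed.

Lemma bernoulli_le (m : nat) t : 0 <= t <= 1 -> 1 - m%:R * t <= (1 - t) ^+ m.
Proof.
move=> /andP[t0 t1]; elim: m => [|m ih]; first by rewrite mul0r subr0 expr0.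
rewrite exprS -natr1; apply: (@le_trans _ _ ((1 - t) * (1 - m%:R * t))).
  have m0 : 0 <= m%:R :> R by []. nra.
by rewrite ler_wpM2l// subr_ge0.
Qed.

(* Brosowski-Deutsch polynomials: they converge boundedly on [0, 1] to the
   indicator of [y < 1/2], except at [y = 1/2]. *)
Definition step (n : nat) y : R := (1 - y ^+ n) ^+ (2 ^ n).

Lemma step_itv n y : 0 <= y <= 1 -> 0 <= step n y <= 1.
Proof.
move=> /andP[y0 y1]; have yn0 : 0 <= y ^+ n by rewrite exprn_ge0.
have yn1 : y ^+ n <= 1 by rewrite exprn_ile1.
have z0 : 0 <= 1 - y ^+ n by rewrite subr_ge0.
by rewrite /step exprn_ge0//= exprn_ile1// gerBl.
Qed.

(** Bernoulli's inequality gives [step n y] >= 1 - 2^n y^n, and 2y < 1. *)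
Lemma cvg_step1 y : 0 <= y < 2^-1 -> step ^~ y @ \oo --> (1 : R).
Proof.
move=> /andP[y0 y2].
have y1 : y <= 1 by lra.
apply: (@squeeze_cvgr _ _ _ _ (fun n => 1 - (2 * y) ^+ n) (cst 1)).
- apply: nearW => n.
  have y01 : 0 <= y <= 1 by rewrite y0.
  have /andP[_ ->] := step_itv n y01.
  rewrite andbT exprMn -natrX; apply: bernoulli_le.
  by rewrite exprn_ge0//= exprn_ile1.
- rewrite -[X in _ --> X]subr0; apply: cvgB; first exact: cvg_cst.
  by apply: cvg_expr; rewrite ger0_norm ?mulr_ge0//; lra.
- exact: cvg_cst.
Qed.

Lemma cvg_step0 y : 2^-1 < y <= 1 -> step ^~ y @ \oo --> (0 : R).
Proof.
move=> /andP[y2 y1].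
have y0 : 0 <= y by lra.
apply: (@squeeze_cvgr _ _ _ _ (cst 0) (fun n => (2 * y)^-1 ^+ n)).
- apply: nearW => n.
  have y01 : 0 <= y <= 1 by rewrite y0.
  have /andP[s0 _] := step_itv n y01; rewrite s0/=.
  have p0 : 0 < (2 * y) ^+ n by rewrite exprn_gt0//; lra.
  rewrite exprVn -[leRHS]mul1r ler_pdivlMr//.
  (* Bernoulli makes the second factor at least (2y)^n, while the product is (1 - y^(2n))^(2^n) <=
     1. Hence [step n y] <= (2y)^(-n), and 2y > 1. *)
  apply: (@le_trans _ _ (step n y * (1 + y ^+ n) ^+ (2 ^ n))).
    rewrite ler_wpM2l//; apply: le_trans (bernoulli_ge _ _).
      by rewrite natrX exprMn lerDr.
    by rewrite exprn_ge0.
  rewrite /step -exprMn -subr_sqr expr1n exprn_ile1//.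
    by rewrite subr_ge0 !exprn_ile1// exprn_ge0.
  by rewrite gerBl sqr_ge0.
- exact: cvg_cst.
- apply: cvg_expr; rewrite ger0_norm ?invr_ge0 ?mulr_ge0//.
  by rewrite invf_lt1; lra.
Qed.

End StepPolynomials.

(** * A function orthogonal to all sines vanishes almost everywhere *)

Section Completeness.
Context {R : realType}.
Local Notation mu := (@lebesgue_measure R).
Local Notation I := (@Iset R).
Implicit Types (f h : R -> R) (x y t : R).

Lemma sinI0 x : sinI 0 x = 0.
Proof. by rewrite /sinI !mul0r sin0. Qed.

Lemma sinI_cosI1 k x :
  sinI k.+1 x * cosI 1 x = 2^-1 * (sinI k.+2 x + sinI k x).
Proof.
have -> : sinI k.+2 x = sin (k.+1%:R * pi / 2 * (x + 1) + 1%:R * pi / 2 * (x + 1)).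
  by rewrite /sinI -(natr1 k.+1); congr sin; lra.
have -> : sinI k x = sin (k.+1%:R * pi / 2 * (x + 1) - 1%:R * pi / 2 * (x + 1)).
  by rewrite /sinI -(natr1 k); congr sin; lra.
by rewrite sinD sinB -/(sinI k.+1 x) -/(cosI 1 x); lra.
Qed.

Lemma cosI1_itv x : -1 <= cosI 1 x <= 1.
Proof. by rewrite cos_geN1 cos_le1. Qed.

Lemma angle_I x : I x -> 0 < 1%:R * pi / 2 * (x + 1) < pi.
Proof.
rewrite /Iset /= in_itv/= => /andP[x0 x1]; have p := pi_gt0 R.
by apply/andP; split; nra.
Qed.

Lemma sinI1_gt0 x : I x -> 0 < sinI 1 x.
Proof. by move=> /angle_I; exact: sin_gt0_pi. Qed.

(** Cosine decreases on [0, pi], so a threshold for [cosI 1] is a threshold for x: steps in the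
    cosine cut out half lines. *)
Lemma cosI1_lt x y : I x -> I y -> (cosI 1 x < cosI 1 y) = (y < x).
Proof.
move=> Ix Iy; have /andP[x0 x1] := angle_I Ix; have /andP[y0 y1] := angle_I Iy.
rewrite /cosI ltr_cos ?in_itv/= ?(ltW x0) ?(ltW x1) ?(ltW y0) ?(ltW y1)//.
by rewrite ltr_pM2l ?ltrD2r// divr_gt0// mul1r pi_gt0.
Qed.

Variable f : R -> R.
Hypothesis fi : integrableI f.
Hypothesis f_sinI : forall k, (0 < k)%N -> intI (fun x => sinI k x * f x) = 0.

Let h x := sinI 1 x * f x.

Lemma integrable_trig_mul (k m : nat) :
  integrableI (fun x => sinI k x * cosI 1 x ^+ m * f x).
Proof.
apply: (@integrableIM _ _ _ 1) => //.
  apply: measurable_funM; first exact: measurable_sinI.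
  by apply: measurable_funX; exact: measurable_cosI.
move=> x; rewrite normrM mulr_ile1// ?sinI_max// normrX exprn_ile1//.
exact: cosI_max.
Qed.

(** Induction on m for all k at once, because a factor [cosI 1] replaces the frequency k by k + 1
    and k - 1. The case k = 0 is included since the recursion reaches it. *)
Lemma intI_sinI_cosI_pow (m k : nat) :
  intI (fun x => sinI k x * cosI 1 x ^+ m * f x) = 0.
Proof.
elim: m k => [|m ih] [|k].
- by rewrite -[RHS]intI0; apply: eq_intI => x; rewrite sinI0 !mul0r.
- by rewrite -[RHS](@f_sinI k.+1)//; apply: eq_intI => x; rewrite expr0 mulr1.
- by rewrite -[RHS]intI0; apply: eq_intI => x; rewrite sinI0 !mul0r.
- rewrite (@eq_intI _ _ (fun x => 2^-1 * (sinI k.+2 x * cosI 1 x ^+ m * f x +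
      sinI k x * cosI 1 x ^+ m * f x))); last first.
    by move=> x; rewrite exprS mulrA sinI_cosI1; ring.
  rewrite intIZ; last by apply: integrableID; exact: integrable_trig_mul.
  rewrite intID; [|exact: integrable_trig_mul..].
  by rewrite !ih addr0 mulr0.
Qed.

Lemma intI_poly (p : {poly R}) : intI (fun x => p.[cosI 1 x] * h x) = 0.
Proof.
rewrite (@eq_intI _ _ (fun x => \sum_(i < size p)
    (p`_i * (sinI 1 x * cosI 1 x ^+ i * f x)))); last first.
  by move=> x; rewrite horner_coef mulr_suml; apply: eq_bigr => i _; rewrite /h; ring.
rewrite intI_sum => [|i]; last exact/integrableIZ/integrable_trig_mul.
rewrite big1// => i _; rewrite intIZ; last exact: integrable_trig_mul.
by rewrite intI_sinI_cosI_pow mulr0.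
Qed.

Let hi : integrableI h.
Proof. exact: (integrableIM (@measurable_sinI R 1) (@sinI_max R 1) fi). Qed.

Lemma intI_half_line x0 : I x0 -> intI (h \_ `]-oo, x0]) = 0.
Proof.
(* The affine map is chosen so that z lies in [0, 1] and z < 1/2 exactly when [cosI 1 x] > a, that
   is, when x < x0. Thus [step n (z x)] is a polynomial in [cosI 1 x] tending to the indicator of x
   < x0. *)
move=> I0; pose a := cosI 1 x0; pose z x := 4^-1 * (a + 2 - cosI 1 x).
pose p n : {poly R} := (1 - (4^-1 *: ((a + 2)%:P - 'X)) ^+ n) ^+ (2 ^ n).
have pE n x : (p n).[cosI 1 x] = step n (z x) by rewrite /p /step /z !hornerE.
have z01 x : 0 <= z x <= 1.
  have := cosI1_itv x; have := cosI1_itv x0; rewrite -/a /z.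
  by move=> /andP[? ?] /andP[? ?]; apply/andP; split; lra.
pose F n x := step n (z x) * h x.
have F0 n : intI (F n) = 0.
  by rewrite -[RHS](intI_poly (p n)); apply: eq_intI => x; rewrite pE.
have mh := integrableI_meas hi.
have mz : measurable_fun I z.
  apply: measurable_funM => //; apply: measurable_funB => //.
  exact: measurable_cosI.
have mF n : measurable_fun I (F n).
  apply: measurable_funM => //; apply: measurable_funX.
  by apply: measurable_funB => //; exact: measurable_funX.
have mg : measurable_fun I (h \_ `]-oo, x0]).
  apply/measurable_restrict => //; first exact: measurable_I.
  by apply: measurable_funS mh; [exact: measurable_I|exact: subIsetl].
have cF : {ae mu, forall x, I x ->
    (EFin \o F n) x @[n --> \oo] --> (EFin \o (h \_ `]-oo, x0])) x}.
  (* At x0 itself z = 1/2, the one value at which the step polynomials are not controlled; a single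
     point is negligible. *)
  have : mu.-negligible [set x0].
    exists [set x0]; split => //; exact: lebesgue_measure_set1.
  apply: negligibleS => x /= /not_implyP[Ix]; apply: contra_notP => /eqP xx0.
  apply: cvg_EFin; first exact: nearW.
  rewrite patchE.
  have [xlt|xgt|/eqP] := ltgtP x x0; last by rewrite (negbTE xx0).
  - rewrite mem_set/= ?in_itv/= ?(ltW xlt)// -[X in _ --> X]mul1r.
    apply: cvgMr_tmp; apply: cvg_step1.
    have /andP[-> _]/= := z01 x.
    by have := cosI1_lt I0 Ix; rewrite xlt -/a /z; lra.
  - rewrite memNset/= ?in_itv/=; last by apply/negP; rewrite -ltNge.
    rewrite -[X in _ --> X](mul0r (h x)).
    apply: cvgMr_tmp; apply: cvg_step0.
    have /andP[_ ->] := z01 x.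
    by have := cosI1_lt Ix I0; rewrite xgt -/a /z andbT; lra.
have Fh : {ae mu, forall x n, I x -> (`|(EFin \o F n) x| <= (`|h x|)%:E)%E}.
  apply: aeW => x n _; rewrite /= lee_fin /F normrM ler_piMl//.
  by have /andP[s0 s1] := step_itv n (z01 x); rewrite ger0_norm.
have mEF n : measurable_fun I (EFin \o F n) by exact/measurable_EFinP.
have mEg : measurable_fun I (EFin \o (h \_ `]-oo, x0])) by exact/measurable_EFinP.
have [_ _ H] := dominated_convergence measurable_I mEF mEg cF (integrableI_norm hi) Fh.
(* Each approximating integral is 0 by orthogonality to polynomials, so the sequence of integrals is
   constant and its limit must be 0. *)
have {}H : (0 : \bar R) @[n --> \oo] --> (\int[mu]_(x in I) ((h \_ `]-oo, x0]) x)%:E)%E.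
  apply: cvg_trans H; apply: near_eq_cvg; apply: nearW => n /=.
  rewrite integralI_fin ?F0//.
  apply: (@le_integrableI _ _ (fun x => `|h x|)) => //; first exact: integrableI_norm.
  move=> x; rewrite /F normrM ler_piMl//.
  by have /andP[s0 s1] := step_itv n (z01 x); rewrite ger0_norm.
exact: (congr1 fine (cvg_unique _ H (cvg_cst _))).
Qed.

Lemma sinI_total : {ae mu, forall x, I x -> f x = 0}.
Proof.
pose g := h \_ I.
have gi A : measurable A -> mu.-integrable A (EFin \o g).
  move=> mA; rewrite /g -restrict_EFin; apply/integrable_restrict => //.
    exact: measurable_I.
  apply: integrableS hi; [exact: measurable_I| |exact: subIsetr].
  by apply: measurableI => //; exact: measurable_I.
have gl : locally_integrable [set: R] g.
  by apply: integrable_locally_restrict hi; exact: measurable_I.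
have F0 x : I x -> \int[mu]_(t in [set` `]-oo, x]]) g t = 0.
  move=> Ix; rewrite /g -Rintegral_mkcondr Rintegral_mkcondl.
  exact: intI_half_line.
have := FTC1Ny (fun y => gi _ (measurable_itv _)) gl.
apply: filterS; first exact: (ae_filter_ringOfSetsType mu).
move=> x /= [_ gx] Ix.
have : g x = 0.
  (* The primitive vanishes on all of I, which is a neighbourhood of x, so its derivative there is
     that of the zero function. Dividing the resulting h x = 0 by [sinI 1 x] > 0 then gives f x =
     0. *)
  rewrite -gx derive1E; transitivity ('D_1 (cst 0 : R -> R) x); last exact: derive_cst.
  apply: near_eq_derive.
  have oI : open (I : set R) by exact: interval_open.
  have : nbhs x I by exact: open_nbhs_nbhs.
  by apply: filterS => y /F0.
rewrite /g patchE mem_set// /h => /eqP.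
by rewrite mulf_eq0 gt_eqF/= ?sinI1_gt0// => /eqP.
Qed.

End Completeness.

(** * The eigenbasis of the Dirichlet Laplacian *)

Section ComplexParts.
Context {R : realType}.
Implicit Types (z w : R[i]) (f g u : R -> R[i]).
Local Notation mu := (@lebesgue_measure R).
Local Notation I := (@Iset R).
Local Notation Re := complex.Re.
Local Notation Im := complex.Im.

(** * Real and imaginary parts, measurability and the squared norm *)

Lemma ReD z w : Re (z + w) = Re z + Re w. Proof. by case: z; case: w. Qed.
Lemma ImD z w : Im (z + w) = Im z + Im w. Proof. by case: z; case: w. Qed.
Lemma ReN z : Re (- z) = - Re z. Proof. by case: z. Qed.
Lemma ImN z : Im (- z) = - Im z. Proof. by case: z. Qed.
Lemma ReM z w : Re (z * w) = Re z * Re w - Im z * Im w.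
Proof. by case: z; case: w. Qed.
Lemma ImM z w : Im (z * w) = Re z * Im w + Im z * Re w.
Proof. by case: z; case: w. Qed.
Lemma Re_conj z : Re z^* = Re z. Proof. by case: z. Qed.
Lemma Im_conj z : Im z^* = - Im z. Proof. by case: z. Qed.

Lemma Re_sum (J : Type) (s : seq J) (F : J -> R[i]) :
  Re (\sum_(j <- s) F j) = \sum_(j <- s) Re (F j).
Proof. by elim/big_ind2 : _ => // x1 y1 x2 y2 <- <-; rewrite ReD. Qed.

Lemma Im_sum (J : Type) (s : seq J) (F : J -> R[i]) :
  Im (\sum_(j <- s) F j) = \sum_(j <- s) Im (F j).
Proof. by elim/big_ind2 : _ => // x1 y1 x2 y2 <- <-; rewrite ImD. Qed.

Lemma complex_ext z w : Re z = Re w -> Im z = Im w -> z = w.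
Proof. by case: z w => [a b] [c d] /= -> ->. Qed.

Lemma normc_sqr z : Normc.normc z ^+ 2 = Re z ^+ 2 + Im z ^+ 2.
Proof. by case: z => a b; rewrite /= sqr_sqrtr// addr_ge0 ?sqr_ge0. Qed.

Definition cmeas f :=
  measurable_fun I (fun x => Re (f x)) /\ measurable_fun I (fun x => Im (f x)).

Lemma cmeas_sqr f : cmeas f ->
  measurable_fun I (fun x => (Normc.normc (f x) ^+ 2)%:E).
Proof.
move=> [mr mi]; apply/measurable_EFinP.
under eq_fun do rewrite normc_sqr.
by apply: measurable_funD; exact: measurable_funX.
Qed.

Lemma cmeasD f g : cmeas f -> cmeas g -> cmeas (fun x => f x + g x).
Proof.
move=> [fr fm] [gr gm]; split.
  by under eq_fun do rewrite ReD; exact: measurable_funD.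
by under eq_fun do rewrite ImD; exact: measurable_funD.
Qed.

Lemma cmeasN f : cmeas f -> cmeas (fun x => - f x).
Proof.
move=> [fr fm]; split.
  by under eq_fun do rewrite ReN; exact: measurable_funN.
by under eq_fun do rewrite ImN; exact: measurable_funN.
Qed.

Lemma cmeasB f g : cmeas f -> cmeas g -> cmeas (fun x => f x - g x).
Proof. by move=> mf mg; apply: cmeasD => //; exact: cmeasN. Qed.

Lemma cmeasM f g : cmeas f -> cmeas g -> cmeas (fun x => f x * g x).
Proof.
move=> [fr fm] [gr gm]; split.
  by under eq_fun do rewrite ReM; apply: measurable_funB; exact: measurable_funM.
by under eq_fun do rewrite ImM; apply: measurable_funD; exact: measurable_funM.
Qed.

Lemma cmeas_cst z : cmeas (fun=> z).
Proof. by split; exact: measurable_cst. Qed.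

Lemma cmeas_sum (J : Type) (s : seq J) (F : J -> R -> R[i]) :
  (forall j, cmeas (F j)) -> cmeas (fun x => \sum_(j <- s) F j x).
Proof.
move=> mF; elim: s => [|j s ih].
  by under eq_fun do rewrite big_nil; exact: cmeas_cst.
by under eq_fun do rewrite big_cons; exact: cmeasD.
Qed.

(** The squared modulus is the sum of the squares of the two parts and dominates each of them. This
    reduces complex integrals to real ones. *)
Lemma L2P f : L2 f <-> sqI (fun x => Re (f x)) /\ sqI (fun x => Im (f x)).
Proof.
split=> [[mr mi fin]|[[mr r2] [mi i2]]]; last first.
  split => //; rewrite /L2sqnorm; under eq_integral do rewrite normc_sqr.
  by rewrite integralI_fin ?ltry//; exact: integrableID.
have n2 : integrableI (fun x => Normc.normc (f x) ^+ 2).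
  apply/integrableP; split; first exact: cmeas_sqr.
  by under eq_integral do rewrite /= ger0_norm ?sqr_ge0//.
by split; split => //; (apply: (le_integrableI _ n2); first exact: measurable_funX);
  move=> x; rewrite ger0_norm ?sqr_ge0// normc_sqr ?lerDl ?lerDr sqr_ge0.
Qed.

Lemma L2_cmeas f : L2 f -> cmeas f. Proof. by case. Qed.

Lemma L2_real (r : R -> R) : L2 (fun x => (r x)%:C) <-> sqI r.
Proof.
split=> [/L2P[]//|sr]; apply/L2P; split => //=.
by apply: (@sqI_bounded _ _ 0) => // x; rewrite normr0.
Qed.

Lemma L2sqnorm_le f (e : R) : cmeas f ->
  (forall x, `|Re (f x)| <= e) -> (forall x, `|Im (f x)| <= e) ->
  (L2sqnorm f <= (4 * e ^+ 2)%:E)%E.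
Proof.
move=> mf re ie; have e0 : 0 <= e by exact: le_trans (re 0).
apply: (@le_trans _ _ (\int[mu]_(x in I) (2 * e ^+ 2)%:E)%E).
  apply: ge0_le_integral => //.
  - exact: measurable_I.
  - by move=> x _; rewrite lee_fin sqr_ge0.
  - exact: cmeas_sqr.
  - move=> x _; rewrite lee_fin normc_sqr.
    by have := re x; have := ie x; rewrite !ler_norml => /andP[? ?] /andP[? ?]; nra.
rewrite integral_cst; last exact: measurable_I.
have -> : (4 * e ^+ 2)%:E = ((2 * e ^+ 2)%:E * 2%:E)%E.
  by rewrite -EFinM; congr EFin; ring.
apply: lee_wpmul2l; first by rewrite lee_fin mulr_ge0// sqr_ge0.
by rewrite -lebesgue_measure_I.
Qed.

(** Integrates |a + b|^2 <= 2 |a|^2 + 2 |b|^2; it serves as the triangle inequality, at the level of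
    squared norms. *)
Lemma L2sqnormD_le f g : cmeas f -> cmeas g ->
  (L2sqnorm (fun x => f x + g x)%R <= 2%:E * L2sqnorm f + 2%:E * L2sqnorm g)%E.
Proof.
move=> mf mg; rewrite /L2sqnorm.
rewrite -!ge0_integralZl//; try exact: measurable_I; try exact: cmeas_sqr;
  try by move=> x _; rewrite lee_fin sqr_ge0.
rewrite -ge0_integralD//; try exact: measurable_I;
  try (by apply/measurable_funeM; exact: cmeas_sqr);
  try by move=> x _; rewrite mule_ge0// lee_fin sqr_ge0.
apply: ge0_le_integral.
- exact: measurable_I.
- by move=> x _; rewrite lee_fin sqr_ge0.
- exact: (cmeas_sqr (cmeasD mf mg)).
- by apply: emeasurable_funD; apply: measurable_funeM; exact: cmeas_sqr.
- move=> x _; rewrite -!EFinM -EFinD lee_fin !normc_sqr ReD ImD.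
  have := sqr_ge0 (Re (f x) - Re (g x)); have := sqr_ge0 (Im (f x) - Im (g x)).
  by rewrite !sqrrB !sqrrD; lra.
Qed.

Lemma L2sqnormB f g : L2sqnorm (fun x => f x - g x) = L2sqnorm (fun x => g x - f x).
Proof.
rewrite /L2sqnorm; apply: eq_integral => x _; rewrite !normc_sqr !ReD !ImD !ReN !ImN.
by congr EFin; ring.
Qed.

Lemma innerE f g : inner f g =
  intI (fun x => Re (f x) * Re (g x) + Im (f x) * Im (g x)) +i*
  intI (fun x => Re (f x) * Im (g x) - Im (f x) * Re (g x)).
Proof.
rewrite /inner /cintegral; congr (_ +i* _); apply: eq_intI => x.
  by rewrite ReM Re_conj Im_conj mulNr opprK.
by rewrite ImM Re_conj Im_conj mulNr.
Qed.

Lemma inner_real (r : R -> R) f : inner (fun x => (r x)%:C) f =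
  intI (fun x => r x * Re (f x)) +i* intI (fun x => r x * Im (f x)).
Proof.
by rewrite innerE; congr (_ +i* _); apply: eq_intI => x /=; rewrite mul0r ?subr0 ?addr0.
Qed.

(** * The sines as an orthonormal total family of eigenfunctions *)

Lemma eDE k : @eD R k = fun x => (sinI k x)%:C. Proof. by []. Qed.

Lemma hilbert_basis_eD : hilbert_basis (fun j : nat => @eD R j.+1).
Proof.
split.
- by move=> j; apply/L2_real; exact: sqI_sinI.
- move=> j k; rewrite !eDE inner_real /= intI_sinI_mul// eqSS.
  rewrite (@eq_intI _ _ (fun=> 0)); last by move=> x; rewrite mulr0.
  by rewrite intI0; case: (_ == _).
- move=> u /L2P[ur ui] u0.
  have ur0 k : (0 < k)%N -> intI (fun x => sinI k x * Re (u x)) = 0.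
    by case: k => // k _; have := u0 k; rewrite eDE inner_real => -[].
  have ui0 k : (0 < k)%N -> intI (fun x => sinI k x * Im (u x)) = 0.
    by case: k => // k _; have := u0 k; rewrite eDE inner_real => -[].
  have zr := sinI_total (integrableI_sq ur) ur0.
  have zi := sinI_total (integrableI_sq ui) ui0.
  move: zr zi; apply: filterS2; first exact: (ae_filter_ringOfSetsType mu).
  move=> x r0 i0 Ix.
  by apply: complex_ext; [exact: r0|exact: i0].
Qed.

Lemma AC_real (F f : R -> R) : (forall x : R, is_derive x 1 F (f x)) -> continuous f ->
  AC_with_derivative (fun x => (F x)%:C) (fun x => (f x)%:C).
Proof.
move=> dF cf x /andP[x1 _]; rewrite /cintegral /= (Rintegral_FTC dF cf x1).
rewrite Rintegral_cst ?mul0r//.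
by apply: complex_ext; rewrite ?ReD ?ImD /=; ring.
Qed.

Lemma A_D_eD k : A_D (@eD R k) (fun x => (k%:R ^+ 2)%:C * eD k x).
Proof.
have eL2 : L2 (@eD R k) by apply/L2_real; exact: sqI_sinI.
have sL2 (c : R) : L2 (fun x => (c * sinI k x)%:C).
  by apply/L2_real; apply: sqIZ; exact: sqI_sinI.
split => //; split.
  have := sL2 (k%:R ^+ 2); congr L2; apply/funext => x.
  by rewrite eDE rmorphM.
pose a : R := k%:R * pi / 2.
(* The eigenfunction and its first two derivatives. Since a = k pi / 2, the factor 4 / pi^2 turns
   a^2 into k^2. *)
exists (@eD R k), (fun x => (a * cos (a * (x + 1)))%:C),
  (fun x => (- a ^+ 2 * sinI k x)%:C); split.
- by apply: aeW.
- rewrite eDE /sinI addNr mulr0 sin0; split => //.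
  have -> : k%:R * pi / 2 * (1 + 1) = k%:R * pi :> R by lra.
  by rewrite sin_natpi.
- apply: AC_real => [x|]; first exact: is_derive_sin_affine.
  by move=> x; apply: cvgM; [exact: cvg_cst|exact: continuous_cos_affine].
- split; first exact: sL2.
  apply: AC_real => [x|].
    have dx := is_derive_cos_affine a x.
    by apply: is_derive_eq; rewrite /GRing.scale/= mulrA mulrN -expr2.
  by move=> x; apply: cvgM; [exact: cvg_cst|exact: continuous_sin_affine].
- apply: aeW => x _; rewrite eDE -!rmorphN -!rmorphM; congr (_%:C).
  have p0 : pi != 0 :> R by rewrite gt_eqF// pi_gt0.
  rewrite /a; move: (sinI k x) => y; move: (@pi R) p0 => q q0.
  by field.
Qed.

Lemma eigenbasis_eD :
  eigenbasis A_D (fun j : nat => j.+1%:R ^+ 2) (fun j => @eD R j.+1).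
Proof. by split=> [|j]; [exact: hilbert_basis_eD|exact: A_D_eD]. Qed.

End ComplexParts.

(** * Unconditional sums in L^2 *)

Section UnconditionalSums.
Context {R : realType}.
Local Notation mu := (@lebesgue_measure R).
Local Notation I := (@Iset R).
Local Notation Re := complex.Re.
Local Notation Im := complex.Im.
Implicit Types (f g u v w : R -> R[i]).

(** v and v0 are both sums of f, hence at distance 0, so g, which sums to v0, also sums to v. A
    common sum of two series thus makes all their sums common. *)
Lemma has_L2sum_transfer (J K : choiceType) (f : J -> R -> R[i])
    (g : K -> R -> R[i]) v0 v :
  (forall j, cmeas (f j)) -> (forall k, cmeas (g k)) ->
  has_L2sum f v0 -> has_L2sum g v0 -> has_L2sum f v -> has_L2sum g v.
Proof.
move=> mf mg [L2v0 f0] [_ g0] [L2v fv]; split => // eps eps0.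
(* Two uses of |a + b|^2 <= 2 |a|^2 + 2 |b|^2: v - v0 costs 4 eps / 10, and v - S then costs 2 * 4
   eps / 10 + 2 * eps / 10 = eps. *)
have e0 : 0 < eps / 10 by rewrite divr_gt0.
have [A0 fA0] := f0 _ e0; have [A fA] := fv _ e0; have [A' gA'] := g0 _ e0.
exists A' => B AB; set S := fun x => \sum_(j <- B) g j x.
pose T x := \sum_(j <- (A0 `|` A)%fset) f j x.
have mv0 := L2_cmeas L2v0; have mv := L2_cmeas L2v.
have mT : cmeas T by exact: cmeas_sum.
have mS : cmeas S by exact: cmeas_sum.
have h1 : (L2sqnorm (fun x => v x - T x)%R < (eps / 10)%:E)%E.
  by apply: fA; exact: fsubsetUr.
have h2 : (L2sqnorm (fun x => T x - v0 x)%R < (eps / 10)%:E)%E.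
  by rewrite L2sqnormB; apply: fA0; exact: fsubsetUl.
have h3 : (L2sqnorm (fun x => v0 x - S x)%R < (eps / 10)%:E)%E by exact: gA'.
have h12 := L2sqnormD_le (cmeasB mv mT) (cmeasB mT mv0).
have h13 := L2sqnormD_le (cmeasB mv mv0) (cmeasB mv0 mS).
have E1 : (fun x => v x - T x + (T x - v0 x)) = (fun x => v x - v0 x).
  by apply/funext => x; rewrite addrA subrK.
have E2 : (fun x => v x - v0 x + (v0 x - S x)) = (fun x => v x - S x).
  by apply/funext => x; rewrite addrA subrK.
rewrite E1 in h12; rewrite E2 in h13.
apply: (le_lt_trans h13).
have n0 h : (0 <= L2sqnorm h)%E.
  by apply: integral_ge0 => x _; rewrite lee_fin sqr_ge0.
have fin h (e : R) : (L2sqnorm h < e%:E)%E -> exists2 r : R, L2sqnorm h = r%:E & r < e.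
  move=> he; have : L2sqnorm h \is a fin_num.
    by rewrite ge0_fin_numE ?n0//; exact: (lt_trans he (ltry _)).
  by move: he => /[swap] /fineK <-; rewrite lte_fin => ?; eexists.
have [r1 E1' r1e] := fin _ _ h1; have [r2 E2' r2e] := fin _ _ h2.
have [r3 E3' r3e] := fin _ _ h3.
move: h12; rewrite E1' E2' E3' -!EFinM -EFinD => h12.
have h12' : (L2sqnorm (fun x => v x - v0 x)%R < (4 * (eps / 10))%:E)%E.
  by apply: (le_lt_trans h12); rewrite lte_fin; lra.
have [r4 E4' r4e] := fin _ _ h12'.
by rewrite E4' -!EFinM -EFinD lte_fin; lra.
Qed.

(** s0 is chosen with sum within e of the supremum of all finite sums, so no finite set containing
    it can add more than e. *)
Lemma sum_tail (J : choiceType) (a : J -> R) (M : R) :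
  (forall j, 0 <= a j) -> (forall s, uniq s -> \sum_(j <- s) a j <= M) ->
  forall e, 0 < e -> exists s0 : seq J, forall s, uniq s -> {subset s0 <= s} ->
    \sum_(j <- s | j \notin s0) a j <= e.
Proof.
move=> a0 aM e e0; pose S := [set r | exists2 s, uniq s & r = \sum_(j <- s) a j].
have hS : has_sup S.
  split; first by exists 0, [::] => //; rewrite big_nil.
  by exists M => _ [s us ->]; exact: aM.
have [_ [s0 us0 ->] s0e] := sup_adherent e0 hS.
exists s0 => s us s0s.
have : \sum_(j <- s) a j <= sup S by apply: ub_le_sup; [exact: hS.2|exists s].
rewrite (bigID (mem s0))/= -big_filter (perm_big s0); last first.
  apply: uniq_perm => //; first exact: filter_uniq.
  by move=> j; rewrite mem_filter /=; apply/andb_idr; exact: s0s.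
lra.
Qed.

(** The common part over s0 cancels, leaving two tails of at most e each. *)
Lemma norm_sum_diff (J : choiceType) (F a : J -> R) (s0 s t : seq J) (e : R) :
  (forall j, `|F j| <= a j) -> uniq s0 -> uniq s -> uniq t ->
  {subset s0 <= s} -> {subset s0 <= t} ->
  \sum_(j <- s | j \notin s0) a j <= e -> \sum_(j <- t | j \notin s0) a j <= e ->
  `|\sum_(j <- s) F j - \sum_(j <- t) F j| <= e + e.
Proof.
move=> Fa us0 us ut s0s s0t ase ate.
have split r : uniq r -> {subset s0 <= r} ->
    \sum_(j <- r) F j = \sum_(j <- s0) F j + \sum_(j <- r | j \notin s0) F j.
  move=> ur s0r; rewrite (bigID (mem s0))/= -big_filter (perm_big s0)//.
  apply: uniq_perm => //; first exact: filter_uniq.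
  by move=> j; rewrite mem_filter /=; apply/andb_idr; exact: s0r.
rewrite split// (split t)// opprD addrACA subrr add0r.
apply: (le_trans (ler_normB _ _)); apply: lerD.
- apply: le_trans ase; apply: le_trans (ler_norm_sum _ _ _) _.
  by apply: ler_sum => j _; exact: Fa.
- apply: le_trans ate; apply: le_trans (ler_norm_sum _ _ _) _.
  by apply: ler_sum => j _; exact: Fa.
Qed.

(* Absolute summability upgrades uniform convergence along one exhausting
   sequence [B] to convergence along the net of all finite sets. *)
Lemma has_L2sum_uniform (J : choiceType) (f : J -> R -> R[i]) (a : J -> R)
    (B : nat -> seq J) (M : R) v :
  (forall j x, `|Re (f j x)| <= a j) -> (forall j x, `|Im (f j x)| <= a j) ->
  (forall n, uniq (B n)) ->
  (forall s : seq J, exists N, forall n, (N <= n)%N -> {subset s <= B n}) ->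
  (forall n, \sum_(j <- B n) a j <= M) ->
  (forall j, cmeas (f j)) -> L2 v ->
  (forall e : R, 0 < e -> exists N, forall n, (N <= n)%N -> forall x,
    `|Re (v x - \sum_(j <- B n) f j x)| <= e /\
    `|Im (v x - \sum_(j <- B n) f j x)| <= e) ->
  has_L2sum f v.
Proof.
move=> rf imf uB exB aM mf L2v cv; split => // eps eps0.
(* The sum over A differs from v by at most 3e: e from [B n], and 2e from two tails. The squared
   norm is then at most 4 (3e)^2 = 36 e^2 <= 36 e <= eps / 2; the bound e <= 1 is what allows e^2 <=
   e. *)
pose e : R := Num.min 1 (eps / 72).
have e0 : 0 < e by rewrite lt_min ltr01/= divr_gt0.
have e1 : e <= 1 by rewrite ge_min lexx.
have ee : e <= eps / 72 by rewrite ge_min lexx orbT.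
have a0 j : 0 <= a j by exact: le_trans (rf j 0).
have aM' s : uniq s -> \sum_(j <- s) a j <= M.
  move=> us; have [N sN] := exB s; apply: le_trans (aM N).
  rewrite [leRHS](bigID (mem s))/=.
  rewrite (_ : \sum_(j <- B N | j \in s) a j = \sum_(j <- s) a j).
    by rewrite lerDl sumr_ge0.
  rewrite -big_filter; apply/perm_big/uniq_perm => //; first exact: filter_uniq.
  by move=> j; rewrite mem_filter /=; apply/andb_idr; exact: sN.
have [s0' tail'] := sum_tail a0 aM' e0.
have {s0' tail'} [s0 us0 tail] : exists2 s0 : seq J, uniq s0 &
    forall s, uniq s -> {subset s0 <= s} -> \sum_(j <- s | j \notin s0) a j <= e.
  exists (undup s0'); first exact: undup_uniq.
  move=> s us ss; under eq_bigl do rewrite mem_undup.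
  by apply: tail' => // j js; apply: ss; rewrite mem_undup.
exists [fset j in s0]%fset => A /fsubsetP sA.
have s0A : {subset s0 <= A} by move=> j js; apply: sA; rewrite in_fset.
have uA : uniq A by exact: fset_uniq.
have [N1 hN1] := exB s0; have [N2 hN2] := cv _ e0.
pose n := maxn N1 N2.
have s0n := hN1 n (leq_maxl _ _); have cn := hN2 n (leq_maxr _ _).
have tA := tail _ uA s0A; have tn := tail _ (uB n) s0n.
have mS : cmeas (fun x => v x - \sum_(j <- A) f j x).
  by apply: cmeasB; [exact: L2_cmeas|exact: cmeas_sum].
apply: (@le_lt_trans _ _ (4 * (3 * e) ^+ 2)%:E); last first.
  by rewrite lte_fin expr2; nra.
apply: L2sqnorm_le => // x.
- have [+ _] := cn x; rewrite !ReD !ReN !Re_sum => vn.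
  have d := norm_sum_diff (fun j => rf j x) us0 (uB n) uA s0n s0A tn tA.
  rewrite -(subrK (\sum_(j <- B n) Re (f j x)) (Re (v x))) -addrA.
  by apply: (le_trans (ler_normD _ _)); lra.
- have [_ +] := cn x; rewrite !ImD !ImN !Im_sum => vn.
  have d := norm_sum_diff (fun j => imf j x) us0 (uB n) uA s0n s0A tn tA.
  rewrite -(subrK (\sum_(j <- B n) Im (f j x)) (Im (v x))) -addrA.
  by apply: (le_trans (ler_normD _ _)); lra.
Qed.

(** The Weierstrass test: increments of S are bounded by those of A, and letting m tend to infinity
    bounds the error by [L - A n], uniformly in x. The bound on w makes it square integrable on
    I. *)
Lemma uniform_series (alpha : nat -> R) (s : nat -> R -> R) (M : R) :
  (forall n, \sum_(j < n) `|alpha j| <= M) ->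
  (forall j, measurable_fun I (s j)) -> (forall j x, `|s j x| <= 1) ->
  exists w : R -> R, [/\ measurable_fun I w, forall x, `|w x| <= M &
    forall e : R, 0 < e -> exists N, forall n, (N <= n)%N -> forall x,
      `|w x - \sum_(j < n) alpha j * s j x| <= e].
Proof.
move=> aM ms s1.
pose A n := \sum_(j < n) `|alpha j|; pose S n x := \sum_(j < n) alpha j * s j x.
have ndA : nondecreasing_seq A.
  by apply/nondecreasing_seqP => n; rewrite /A big_ord_recr/= lerDl.
have cA : cvgn A by apply: nondecreasing_is_cvgn => //; exists M => _ [n _ <-]; exact: aM.
pose L := limn A.
have AL n : A n <= L by exact: nondecreasing_cvgn_le.
have SS n m x : (n <= m)%N -> `|S m x - S n x| <= A m - A n.
  move=> /subnKC <-; elim: (m - n)%N => [|k ih]; first by rewrite addn0 !subrr normr0.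
  rewrite addnS /S /A !big_ord_recr/= -/(S _ x) -/(A _).
  rewrite addrAC [leRHS]addrAC; apply: (le_trans (ler_normD _ _)); apply: lerD => //.
  by rewrite normrM ler_piMr.
have tail e : 0 < e -> exists N, forall n, (N <= n)%N -> L - A n <= e.
  move=> e0; have /cvgrPdist_le /(_ e e0) [N _ HN] := cA.
  by exists N => n /HN; rewrite ger0_norm// subr_ge0.
have cS x : cvgn (S ^~ x).
  have -> : S ^~ x = series (fun j => alpha j * s j x) by rewrite seriesEord.
  apply: normed_cvg; rewrite /normed_series_of seriesEord; apply: nondecreasing_is_cvgn.
    by apply/nondecreasing_seqP => n /=; rewrite big_ord_recr/= lerDl.
  exists M => _ [n _ <-].
  apply: le_trans (aM n); apply: ler_sum => j _ /=.
  by rewrite normrM ler_piMr.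
pose w x := limn (S ^~ x).
have Sw x : S n x @[n --> \oo] --> w x by exact: cS.
have wS n x : `|w x - S n x| <= L - A n.
  have c1 : `|S m x - S n x| @[m --> \oo] --> `|w x - S n x|.
    by apply: cvg_norm; apply: cvgB => //; exact: cvg_cst.
  have c2 : A m - A n @[m --> \oo] --> L - A n by apply: cvgB => //; exact: cvg_cst.
  apply: (ler_cvg_to c1 c2); exists n => // m /= nm; exact: SS.
exists w; split.
- apply: (@measurable_fun_cvg _ _ _ _ S) => [n|x _]; last exact: Sw.
  rewrite /S; apply: measurable_sum => j; apply: measurable_funM => //.
- move=> x; apply: (ler_cvg_to (cvg_norm (Sw x)) (cvg_cst M)).
  apply: nearW => n; apply: le_trans (aM n).
  apply: (le_trans (ler_norm_sum _ _ _)); apply: ler_sum => j _.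
  by rewrite normrM ler_piMr.
- move=> e e0; have [N HN] := tail _ e0; exists N => n nN x.
  exact: (le_trans (wS n x) (HN _ nN)).
Qed.

End UnconditionalSums.

(** * Fourier coefficients of even and odd parts *)

Section PlaneWaves.
Context {R : realType}.
Local Notation mu := (@lebesgue_measure R).
Local Notation I := (@Iset R).
Local Notation Re := complex.Re.
Local Notation Im := complex.Im.
Implicit Types (f q : R -> R) (u : R -> R[i]) (r x : R).

Let kappa : R := (Num.sqrt 2)^-1.

(** Both [ep] and [ea] consist of such waves, with r in pi Z and in pi (Z + 1/2); a real frequency
    lets both cases share the passage from r to -r. *)
Definition wave r x : R[i] := ((Num.sqrt 2)^-1)%:C * expi (r * x).

Lemma Re_wave r x : Re (wave r x) = kappa * cos (r * x).
Proof. by rewrite ReM /= mul0r subr0. Qed.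

Lemma Im_wave r x : Im (wave r x) = kappa * sin (r * x).
Proof. by rewrite ImM /= mul0r addr0. Qed.

Lemma kappa_sqr : kappa * kappa = 2^-1.
Proof. by rewrite -expr2 exprVn sqr_sqrtr. Qed.

Lemma measurable_cos r : measurable_fun I (fun x => cos (r * x)).
Proof.
apply: continuous_measI => x; apply: (@continuous_comp _ _ _ (fun y => r * y) cos).
  by apply: cvgM; [exact: cvg_cst|exact: cvg_id].
exact: continuous_cos.
Qed.

Lemma measurable_sin r : measurable_fun I (fun x => sin (r * x)).
Proof.
apply: continuous_measI => x; apply: (@continuous_comp _ _ _ (fun y => r * y) sin).
  by apply: cvgM; [exact: cvg_cst|exact: cvg_id].
exact: continuous_sin.
Qed.

Lemma cmeas_wave r : cmeas (wave r).
Proof.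
split.
- under eq_fun do rewrite Re_wave.
  by apply: measurable_funM; [exact: measurable_cst|exact: measurable_cos].
- under eq_fun do rewrite Im_wave.
  by apply: measurable_funM; [exact: measurable_cst|exact: measurable_sin].
Qed.

Lemma integrableI_cosM r f : integrableI f -> integrableI (fun x => cos (r * x) * f x).
Proof. exact: (integrableIM (measurable_cos r) (fun x => cos_max (r * x))). Qed.

Lemma integrableI_sinM r f : integrableI f -> integrableI (fun x => sin (r * x) * f x).
Proof. exact: (integrableIM (measurable_sin r) (fun x => sin_max (r * x))). Qed.

Definition cosC r f : R := intI (fun x => cos (r * x) * f x).
Definition sinC r f : R := intI (fun x => sin (r * x) * f x).

Lemma cosC_oppr r f : cosC (- r) f = cosC r f.
Proof. by apply: eq_intI => x; rewrite mulNr cosN. Qed.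

Lemma cosC_reflect r f : integrableI f -> cosC r (fun x => f (- x)) = cosC r f.
Proof.
move=> fi; rewrite /cosC -[RHS](intI_opp (integrableI_cosM r fi)).
by apply: eq_intI => x; rewrite mulrN cosN.
Qed.

Lemma sinC_reflect r f : integrableI f -> sinC r (fun x => f (- x)) = - sinC r f.
Proof.
move=> fi; have gi := integrableI_opp (integrableI_sinM r fi).
rewrite -[RHS]mulN1r -[X in _ * X](intI_opp (integrableI_sinM r fi)) -intIZ//.
by apply: eq_intI => x; rewrite mulrN sinN mulN1r mulNr opprK.
Qed.

Lemma sinC_opp r f : integrableI f -> sinC (- r) f = - sinC r f.
Proof.
move=> fi; rewrite -[RHS]mulN1r -intIZ; last exact: integrableI_sinM.
by apply: eq_intI => x; rewrite mulNr sinN mulN1r mulNr.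
Qed.

Lemma inner_wave r u : integrableI (fun x => Re (u x)) ->
  integrableI (fun x => Im (u x)) ->
  inner (wave r) u =
  (kappa * (cosC r (fun x => Re (u x)) + sinC r (fun x => Im (u x)))) +i*
  (kappa * (cosC r (fun x => Im (u x)) - sinC r (fun x => Re (u x)))).
Proof.
move=> ur ui; rewrite innerE; congr (_ +i* _).
- rewrite /cosC /sinC -intID; [|exact: integrableI_cosM|exact: integrableI_sinM].
  rewrite -intIZ; last first.
    by apply: integrableID; [exact: integrableI_cosM|exact: integrableI_sinM].
  by apply: eq_intI => x; rewrite Re_wave Im_wave; ring.
- rewrite /cosC /sinC -intIB; [|exact: integrableI_cosM|exact: integrableI_sinM].
  rewrite -intIZ; last first.
    by apply: integrableIB; [exact: integrableI_cosM|exact: integrableI_sinM].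
  by apply: eq_intI => x; rewrite Re_wave Im_wave; ring.
Qed.

(** s = 1 and s = -1 give the even and the odd projection. Reflection preserves cosine coefficients
    and negates sine coefficients, so each projection keeps one kind and kills the other. *)
Lemma cosC_symmetrize r f (s : R) : integrableI f ->
  cosC r (fun x => 2^-1 * (f x + s * f (- x))) = 2^-1 * (1 + s) * cosC r f.
Proof.
move=> fi; have fo := integrableI_opp fi.
rewrite /cosC (@eq_intI _ _ (fun x => 2^-1 * (cos (r * x) * f x) +
    2^-1 * s * (cos (r * x) * f (- x)))); last by move=> x; ring.
rewrite intID; [|exact/integrableIZ/integrableI_cosM..].
rewrite !intIZ; [|exact: integrableI_cosM..].
by rewrite -!/(cosC r _) (cosC_reflect r fi); ring.
Qed.

Lemma sinC_symmetrize r f (s : R) : integrableI f ->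
  sinC r (fun x => 2^-1 * (f x + s * f (- x))) = 2^-1 * (1 - s) * sinC r f.
Proof.
move=> fi; have fo := integrableI_opp fi.
rewrite /sinC (@eq_intI _ _ (fun x => 2^-1 * (sin (r * x) * f x) +
    2^-1 * s * (sin (r * x) * f (- x)))); last by move=> x; ring.
rewrite intID; [|exact/integrableIZ/integrableI_sinM..].
rewrite !intIZ; [|exact: integrableI_sinM..].
by rewrite -!/(sinC r _) (sinC_reflect r fi); ring.
Qed.

Lemma Re_half (z : R[i]) : Re (2^-1 * z) = 2^-1 * Re z.
Proof.
rewrite -[2]/(2%:R) -[_%:R](rmorph_nat (real_complex R)) -fmorphV.
by rewrite ReM /= mul0r subr0.
Qed.

Lemma Im_half (z : R[i]) : Im (2^-1 * z) = 2^-1 * Im z.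
Proof.
rewrite -[2]/(2%:R) -[_%:R](rmorph_nat (real_complex R)) -fmorphV.
by rewrite ImM /= mul0r addr0.
Qed.

Lemma inner_wave_P_odd r u : integrableI (fun x => Re (u x)) ->
  integrableI (fun x => Im (u x)) ->
  inner (wave r) (P_odd u) =
  (kappa * sinC r (fun x => Im (u x))) +i* (- (kappa * sinC r (fun x => Re (u x)))).
Proof.
move=> ur ui; have uro := integrableI_opp ur; have uio := integrableI_opp ui.
have rE : (fun x => Re (P_odd u x)) =
    (fun x => 2^-1 * (Re (u x) + (-1) * Re (u (- x)))).
  by apply/funext => x; rewrite /P_odd Re_half ReD ReN mulN1r.
have iE : (fun x => Im (P_odd u x)) =
    (fun x => 2^-1 * (Im (u x) + (-1) * Im (u (- x)))).
  by apply/funext => x; rewrite /P_odd Im_half ImD ImN mulN1r.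
rewrite inner_wave ?rE ?iE; first last.
- exact/integrableIZ/integrableID/integrableIZ.
- exact/integrableIZ/integrableID/integrableIZ.
rewrite (cosC_symmetrize r (-1) ur) (cosC_symmetrize r (-1) ui).
rewrite (sinC_symmetrize r (-1) ur) (sinC_symmetrize r (-1) ui).
by congr (_ +i* _); field.
Qed.

Lemma inner_wave_P_even r u : integrableI (fun x => Re (u x)) ->
  integrableI (fun x => Im (u x)) ->
  inner (wave r) (P_even u) =
  (kappa * cosC r (fun x => Re (u x))) +i* (kappa * cosC r (fun x => Im (u x))).
Proof.
move=> ur ui; have uro := integrableI_opp ur; have uio := integrableI_opp ui.
have rE : (fun x => Re (P_even u x)) =
    (fun x => 2^-1 * (Re (u x) + 1 * Re (u (- x)))).
  by apply/funext => x; rewrite /P_even Re_half ReD mul1r.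
have iE : (fun x => Im (P_even u x)) =
    (fun x => 2^-1 * (Im (u x) + 1 * Im (u (- x)))).
  by apply/funext => x; rewrite /P_even Im_half ImD mul1r.
rewrite inner_wave ?rE ?iE; first last.
- exact/integrableIZ/integrableID/integrableIZ.
- exact/integrableIZ/integrableID/integrableIZ.
rewrite (cosC_symmetrize r 1 ur) (cosC_symmetrize r 1 ui).
rewrite (sinC_symmetrize r 1 ur) (sinC_symmetrize r 1 ui).
by congr (_ +i* _); field.
Qed.

Lemma inner_wave_even r (C : R -> R) : integrableI C ->
  {ae mu, forall x, I x -> C (- x) = C x} ->
  inner (wave r) (fun x => (C x)%:C) = (kappa * cosC r C)%:C.
Proof.
move=> Ci Cev.
(* Reflection negates the sine coefficient, while evenness almost everywhere preserves it. The inner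
   product is therefore real and unchanged under r to -r. *)
have sC0 : sinC r C = 0.
  have : sinC r (fun x => C (- x)) = sinC r C.
    rewrite /sinC /intI /Rintegral; congr fine; apply: ae_eq_integral => //.
    - exact: measurable_I.
    - apply/measurable_EFinP; apply: integrableI_meas.
      exact/integrableI_sinM/integrableI_opp.
    - by apply/measurable_EFinP; apply: integrableI_meas; exact: integrableI_sinM.
    - move: Cev; apply: filterS; first exact: (ae_filter_ringOfSetsType mu).
      by move=> x Cx Ix; rewrite Cx.
  rewrite sinC_reflect// => /eqP; rewrite eq_sym -addr_eq0 -mulr2n mulrn_eq0.
  by move=> /eqP.
have i0 : integrableI (fun _ : R => 0).
  by apply: (@integrableI_bounded _ _ 0) => // x; rewrite normr0.
rewrite inner_wave//= sC0.
have -> : cosC r (fun=> 0) = 0 by rewrite -[RHS]intI0; apply: eq_intI => x; rewrite mulr0.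
have -> : sinC r (fun=> 0) = 0 by rewrite -[RHS]intI0; apply: eq_intI => x; rewrite mulr0.
by rewrite subr0 mulr0 addr0.
Qed.

(** The factor 2^-1 is [kappa * kappa], from the coefficient of u and from the wave; the [kappa] of
    C is part of c. *)
Lemma Re_odd_term r x (c s1 s2 : R) :
  Re (c%:C * ((kappa * s2) +i* (- (kappa * s1))) * wave r x) =
  2^-1 * c * (s2 * cos (r * x) + s1 * sin (r * x)).
Proof. by rewrite ReM Re_wave Im_wave ReM ImM /= -kappa_sqr; ring. Qed.

Lemma Im_odd_term r x (c s1 s2 : R) :
  Im (c%:C * ((kappa * s2) +i* (- (kappa * s1))) * wave r x) =
  2^-1 * c * (s2 * sin (r * x) - s1 * cos (r * x)).
Proof. by rewrite ImM Re_wave Im_wave ReM ImM /= -kappa_sqr; ring. Qed.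

Lemma Re_even_term r x (c s1 s2 : R) :
  Re (c%:C * ((kappa * s1) +i* (kappa * s2)) * wave r x) =
  2^-1 * c * (s1 * cos (r * x) - s2 * sin (r * x)).
Proof. by rewrite ReM Re_wave Im_wave ReM ImM /= -kappa_sqr; ring. Qed.

Lemma Im_even_term r x (c s1 s2 : R) :
  Im (c%:C * ((kappa * s1) +i* (kappa * s2)) * wave r x) =
  2^-1 * c * (s1 * sin (r * x) + s2 * cos (r * x)).
Proof. by rewrite ImM Re_wave Im_wave ReM ImM /= -kappa_sqr; ring. Qed.

Lemma trig_bound (c s1 s2 a b : R) : `|a| <= 1 -> `|b| <= 1 ->
  `|2^-1 * c * (s1 * a + s2 * b)| <= `|c| * (`|s1| + `|s2|).
Proof.
move=> a1 b1; rewrite normrM normrM -mulrA.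
rewrite (_ : `|2^-1| = 2^-1 :> R); last by rewrite ger0_norm.
have h : `|c| * `|s1 * a + s2 * b| <= `|c| * (`|s1| + `|s2|).
  rewrite ler_wpM2l//; apply: (le_trans (ler_normD _ _)).
  by rewrite !normrM lerD// ler_piMr.
have : 0 <= `|c| * `|s1 * a + s2 * b| by rewrite mulr_ge0.
lra.
Qed.

End PlaneWaves.

(** * Folding a convolution series into a sine series *)

Section Folding.
Context {R : realType}.
Local Notation Re := complex.Re.
Local Notation Im := complex.Im.
Implicit Types (u v : R -> R[i]).

(** The integers from -n to b + n - 1. For b = 1 they are symmetric about 0; for b = 0 they are
    symmetric about -1/2, so that the frequencies k + 1/2 come in opposite pairs. *)
Definition int_range (b n : nat) : seq int :=
  map Posz (iota 0 (b + n)) ++ map Negz (iota 0 n).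

Lemma int_range_uniq b n : uniq (int_range b n).
Proof.
rewrite cat_uniq !map_inj_uniq ?iota_uniq//=; try by move=> ? ? [].
by rewrite andbT; apply/hasPn => _ /mapP[i _ ->]; apply/mapP => -[].
Qed.

Lemma int_range_exhaust b (s : seq int) :
  exists N, forall n, (N <= n)%N -> {subset s <= int_range b n}.
Proof.
elim: s => [|k s [N HN]]; first by exists 0%N.
pose m := if k is Posz i then i.+1 else if k is Negz i then i.+1 else 0%N.
exists (maxn N m) => n; rewrite geq_max => /andP[Nn mn] j.
rewrite inE => /predU1P[->|]; last exact: HN.
rewrite mem_cat; case: k @m mn => i /= mn.
- by rewrite map_f// mem_iota /= add0n (leq_trans mn)// leq_addl.
- by rewrite orbC map_f// mem_iota /= add0n.
Qed.

Lemma sum_int_range (V : nmodType) (F : int -> V) b n :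
  \sum_(k <- int_range b n) F k =
  \sum_(i < b) F i + \sum_(m < n) (F (b + m)%N + F (Negz m)).
Proof.
have iotaE m : iota 0 m = index_iota 0 m by rewrite /index_iota subn0.
by rewrite big_cat !big_map !iotaE !big_mkord big_split_ord/= big_split/= addrA.
Qed.

Lemma sum_double (V : nmodType) (F : nat -> V) n :
  \sum_(j < n.*2) F j = \sum_(m < n) (F m.*2 + F m.*2.+1).
Proof.
elim: n => [|n ih]; first by rewrite !big_ord0.
by rewrite doubleS !big_ord_recr/= ih addrA.
Qed.

Definition sine_term (t : nat -> R) u (j : nat) : R -> R[i] :=
  fun x => (t j)%:C * inner (eD j.+1) u * eD j.+1 x.

(** A bound for [sine_term t u j x] independent of x, used as the summable majorant. *)
Definition sine_weight (t : nat -> R) u (j : nat) : R :=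
  `|t j| * (`|intI (fun x => sinI j.+1 x * Re (u x))| +
            `|intI (fun x => sinI j.+1 x * Im (u x))|).

Definition bounded_term (z : R[i]) (r : R) := `|Re z| <= r /\ `|Im z| <= r.

Lemma sine_weight_ge0 t u j : 0 <= sine_weight t u j.
Proof. by rewrite mulr_ge0// addr_ge0. Qed.

Lemma cmeas_eD k : cmeas (@eD R k).
Proof. by split; [exact: measurable_sinI|exact: measurable_cst]. Qed.

Lemma Re_sine_term t u j x : Re (sine_term t u j x) =
  t j * intI (fun x => sinI j.+1 x * Re (u x)) * sinI j.+1 x.
Proof. by rewrite /sine_term eDE inner_real !ReM /=; ring. Qed.

Lemma Im_sine_term t u j x : Im (sine_term t u j x) =
  t j * intI (fun x => sinI j.+1 x * Im (u x)) * sinI j.+1 x.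
Proof. by rewrite /sine_term eDE inner_real ImM ReM ImM /=; ring. Qed.

Lemma sine_term_bound t u j x :
  bounded_term (sine_term t u j x) (sine_weight t u j).
Proof.
have s1 := sinI_max j.+1 x; split.
  rewrite Re_sine_term !normrM; apply: (le_trans (ler_piMr _ s1)) => //.
  by rewrite ler_wpM2l// lerDl.
rewrite Im_sine_term !normrM; apply: (le_trans (ler_piMr _ s1)) => //.
by rewrite ler_wpM2l// lerDr.
Qed.

(** Termwise |t s| <= t^2 + s^2; applied to the coefficients of C and of u, both controlled by
    Bessel's inequality. *)
Lemma sum_norm_mul_le (t s : nat -> R) (M N : R) :
  (forall n, \sum_(j < n) t j ^+ 2 <= M) -> (forall n, \sum_(j < n) s j ^+ 2 <= N) ->
  forall n, \sum_(j < n) `|t j * s j| <= M + N.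
Proof.
move=> tM sN n; apply: (le_trans _ (lerD (tM n) (sN n))).
rewrite -big_split/=; apply: ler_sum => j _.
by rewrite ler_norml; apply/andP; split; nra.
Qed.

Lemma sine_series (t : nat -> R) (M : R) u :
  (forall n, \sum_(j < n) t j ^+ 2 <= M) -> L2 u ->
  exists v K, [/\ L2 v,
    forall n, \sum_(j < n) sine_weight t u j <= K &
    forall e : R, 0 < e -> exists N, forall n, (N <= n)%N -> forall x,
      bounded_term (v x - \sum_(j < n) sine_term t u j x) e].
Proof.
move=> tM /L2P[ur ui].
have rM := @sum_norm_mul_le t (fun j => intI (fun x => sinI j.+1 x * Re (u x)))
  _ _ tM (fun n => Bessel_sinI n ur).
have iM := @sum_norm_mul_le t (fun j => intI (fun x => sinI j.+1 x * Im (u x)))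
  _ _ tM (fun n => Bessel_sinI n ui).
set Mr := _ + _ in rM; set Mi := _ + _ in iM.
have ms j : measurable_fun Iset (@sinI R j.+1) by exact: measurable_sinI.
have [w1 [mw1 bw1 cw1]] := @uniform_series R
  (fun j => t j * intI (fun x => sinI j.+1 x * Re (u x)))
  _ _ rM ms (fun j => sinI_max j.+1).
have [w2 [mw2 bw2 cw2]] := @uniform_series R
  (fun j => t j * intI (fun x => sinI j.+1 x * Im (u x)))
  _ _ iM ms (fun j => sinI_max j.+1).
exists (fun x => w1 x +i* w2 x), (Mr + Mi); split.
- by apply/L2P; split; [exact: sqI_bounded bw1|exact: sqI_bounded bw2].
- move=> n; apply: le_trans (lerD (rM n) (iM n)).
  rewrite -big_split/=; apply: ler_sum => j _.
  by rewrite /sine_weight mulrDr !normrM.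
- move=> e e0; have [N1 HN1] := cw1 _ e0; have [N2 HN2] := cw2 _ e0.
  exists (maxn N1 N2) => n; rewrite geq_max => /andP[n1 n2] x.
  split.
    rewrite ReD ReN Re_sum; under eq_bigr do rewrite Re_sine_term.
    exact: HN1.
  rewrite ImD ImN Im_sum; under eq_bigr do rewrite Im_sine_term.
  exact: HN2.
Qed.

(* The terms of index [b + m] and [Negz m = - (m + 1)] of a convolution add up
   to those of index [2m] and [2m + 1] of the sine expansion; the shift is
   [b = 1] in the periodic and [b = 0] in the antiperiodic case. *)
Lemma op_eq_fold (C : R -> R[i]) (e : int -> R -> R[i])
    (P : (R -> R[i]) -> R -> R[i]) (phi : R -> R[i]) (t : nat -> R) (M : R)
    (b : nat) :
  (forall j : nat, phi (j.+1%:R ^+ 2) = (t j)%:C) ->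
  (forall n, \sum_(j < n) t j ^+ 2 <= M) ->
  (forall k, cmeas (e k)) ->
  (forall u, L2 u ->
    let f k x := inner (e k) C * inner (e k) (P u) * e k x in
    [/\ forall i x, (i < b)%N -> f (Posz i) x = 0,
        forall (m : nat) x, f (Posz (b + m)) x + f (Negz m) x =
          sine_term t u m.*2 x + sine_term t u m.*2.+1 x &
        forall (m : nat) (k : int) x, k = Posz (b + m) \/ k = Negz m ->
          bounded_term (f k x) (sine_weight t u m.*2 + sine_weight t u m.*2.+1)]) ->
  op_eq (fun h => conv_in e C (P h)) (phi_A_D phi).
Proof.
move=> phiE tM me He u L2u; have [f0 fg fb] := He u L2u.
set f := (fun k x => inner (e k) C * inner (e k) (P u) * e k x) in f0 fg fb.
have [v0 [K [L2v0 gK gv]]] := @sine_series t M u tM L2u.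
have mf k : cmeas (f k) by apply: cmeasM => //; exact: cmeas_cst.
have mg j : cmeas (sine_term t u j).
  by apply: cmeasM; [exact: cmeas_cst|exact: cmeas_eD].
pose a j := sine_weight t u j.
have a0 j : 0 <= a j by exact: sine_weight_ge0.
have g_sum : has_L2sum (sine_term t u) v0.
  have iotaE n (V : nmodType) (F : nat -> V) :
      \sum_(j <- iota 0 n) F j = \sum_(j < n) F j.
    by rewrite -[n in LHS](subn0 n) -/(index_iota 0 n) big_mkord.
  apply: (@has_L2sum_uniform _ _ _ a (iota 0) K) => //.
  - by move=> j x; exact: (sine_term_bound t u j x).1.
  - by move=> j x; exact: (sine_term_bound t u j x).2.
  - by move=> n; exact: iota_uniq.
  - move=> s; exists (\max_(j <- s) j).+1 => n sn j js.
    by rewrite mem_iota /= add0n (leq_trans _ sn)// ltnS; exact: leq_bigmax_seq.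
  - by move=> n; rewrite iotaE.
  - move=> r r0; have [N HN] := gv _ r0; exists N => n nN x.
    by rewrite iotaE; exact: HN.
(* Both members of a pair receive the whole weight of the pair, which is why the total bound becomes
   2K. The first b indices have zero terms and receive weight 0. *)
pose af (k : int) : R := match k with
  | Posz i => if (i < b)%N then 0 else a (i - b).*2 + a (i - b).*2.+1
  | Negz m => a m.*2 + a m.*2.+1 end.
have fa k x : bounded_term (f k x) (af k).
  case: k => m /=; last by apply: fb; right.
  case: ifPn => [mb|]; first by rewrite [f _ _](f0 m x mb); split; rewrite /= normr0.
  by rewrite -leqNgt => bm; apply: fb; left; rewrite subnKC.
have f_sum : has_L2sum f v0.
  apply: (@has_L2sum_uniform _ _ _ af (int_range b) (2 * K)) => //.
  - by move=> j x; exact: (fa j x).1.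
  - by move=> j x; exact: (fa j x).2.
  - exact: int_range_uniq.
  - exact: int_range_exhaust.
  - move=> n; rewrite sum_int_range big1 ?add0r; last first.
      by move=> i _ /=; rewrite ltn_ord.
    have -> : \sum_(m < n) (af (b + m)%N + af (Negz m)) =
        2 * \sum_(m < n) (a m.*2 + a m.*2.+1).
      rewrite mulr_sumr; apply: eq_bigr => m _ /=.
      by rewrite ltnNge leq_addr/= addKn mulr_natl mulr2n.
    by rewrite -sum_double ler_wpM2l.
  - move=> r r0; have [N HN] := gv _ r0; exists N => n nN x.
    rewrite sum_int_range big1 ?add0r; last by move=> i _; exact: f0.
    have -> : \sum_(m < n) (f (b + m)%N x + f (Negz m) x) =
        \sum_(m < n) (sine_term t u m.*2 x + sine_term t u m.*2.+1 x).
      by apply: eq_bigr => m _; exact: fg.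
    (* n pairs of waves are the first 2n sine terms, and 2n >= N. *)
    rewrite -(sum_double (fun j => sine_term t u j x)); apply: HN.
    by rewrite (leq_trans nN)// -addnn leq_addr.
have TE v : phi_A_D phi u v <-> has_L2sum (sine_term t u) v.
  rewrite /phi_A_D /functional_calculus.
  have -> : (fun (j : nat) x => phi (j.+1%:R ^+ 2) * inner (eD j.+1) u * eD j.+1 x) =
      sine_term t u by apply/funext => j; apply/funext => x; rewrite phiE.
  by split=> [[]//|]; split => //; exact: eigenbasis_eD.
split; first by exists v0.
move=> v; split=> [fv|/TE gv'].
  by apply/TE; exact: (has_L2sum_transfer mf mg f_sum g_sum fv).
exact: (has_L2sum_transfer mg mf g_sum f_sum gv').
Qed.

Lemma bounded_on_sigma (phi : R -> R[i]) (t : nat -> R) (M : R) :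
  (forall j : nat, phi (j.+1%:R ^+ 2) = (t j)%:C) ->
  (forall n, \sum_(j < n) t j ^+ 2 <= M) -> bounded_on sigma_A_D phi.
Proof.
(* Each single square is at most M, and |t| <= 1 + t^2. *)
move=> phiE tM; exists (1 + M) => _ [[//|j] _ <-]; rewrite phiE /=.
rewrite expr0n addr0 sqrtr_sqr.
have tj : t j ^+ 2 <= M.
  apply: le_trans (tM j.+1); rewrite big_ord_recr/= lerDr sumr_ge0// => i _.
  exact: sqr_ge0.
by rewrite ler_norml; apply/andP; split; nra.
Qed.

End Folding.

(** * Convolution with an even function *)

Section Coefficients.
Context {R : realType}.
Local Notation mu := (@lebesgue_measure R).
Local Notation I := (@Iset R).
Local Notation Re := complex.Re.
Local Notation Im := complex.Im.
Implicit Types (f C : R -> R) (u : R -> R[i]) (r x : R).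
Let kappa : R := (Num.sqrt 2)^-1.

Lemma ep_wave k : @ep R k = wave (pi * k%:~R). Proof. by []. Qed.

Lemma ea_wave k : @ea R k = wave (pi * (k%:~R + 2^-1)). Proof. by []. Qed.

Lemma ea_NegzE (m : nat) : @ea R (Negz m) = wave (- (pi * (m%:R + 2^-1))).
Proof.
rewrite ea_wave NegzE mulrNz; congr wave.
by rewrite -[_ *~ _]/(m.+1%:R) -natr1; lra.
Qed.

Lemma ep_NegzE (m : nat) : @ep R (Negz m) = wave (- (pi * m.+1%:R)).
Proof. by rewrite ep_wave NegzE mulrNz mulrN. Qed.

(** At even index 2m, replacing x + 1 by x shifts the phase by m pi, whence the sign. At odd index
    2m + 1 there is a further pi / 2, which turns the sine into a cosine. *)
Lemma cosI_even (m : nat) x : cosI m.*2 x = (-1) ^+ m * cos (pi * m%:R * x).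
Proof.
rewrite /cosI -cos_natpi -mul2n natrM.
have -> : 2 * m%:R * pi / 2 * (x + 1) = m%:R * pi + pi * m%:R * x by lra.
by rewrite cosD sin_natpi mul0r subr0.
Qed.

Lemma sinI_even (m : nat) x : sinI m.*2 x = (-1) ^+ m * sin (pi * m%:R * x).
Proof.
rewrite /sinI -cos_natpi -mul2n natrM.
have -> : 2 * m%:R * pi / 2 * (x + 1) = m%:R * pi + pi * m%:R * x by lra.
by rewrite sinD sin_natpi mul0r add0r.
Qed.

Lemma sinI_odd (m : nat) x :
  sinI m.*2.+1 x = (-1) ^+ m * cos (pi * (m%:R + 2^-1) * x).
Proof.
rewrite /sinI -cos_natpi -natr1 -mul2n natrM.
have -> : (2 * m%:R + 1) * pi / 2 * (x + 1) =
  (m%:R * pi + pi * (m%:R + 2^-1) * x) + pi / 2 by lra.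
by rewrite sinDpihalf cosD sin_natpi mul0r subr0.
Qed.

Lemma intI_cosI_even (m : nat) f : integrableI f ->
  intI (fun x => cosI m.*2 x * f x) = (-1) ^+ m * cosC (pi * m%:R) f.
Proof.
move=> fi; rewrite /cosC -intIZ; last exact: integrableI_cosM.
by apply: eq_intI => x; rewrite cosI_even mulrA.
Qed.

Lemma intI_sinI_even (m : nat) f : integrableI f ->
  intI (fun x => sinI m.*2 x * f x) = (-1) ^+ m * sinC (pi * m%:R) f.
Proof.
move=> fi; rewrite /sinC -intIZ; last exact: integrableI_sinM.
by apply: eq_intI => x; rewrite sinI_even mulrA.
Qed.

Lemma intI_sinI_odd (m : nat) f : integrableI f ->
  intI (fun x => sinI m.*2.+1 x * f x) = (-1) ^+ m * cosC (pi * (m%:R + 2^-1)) f.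
Proof.
move=> fi; rewrite /cosC -intIZ; last exact: integrableI_cosM.
by apply: eq_intI => x; rewrite sinI_odd mulrA.
Qed.

Lemma sign_sqr (m : nat) (a b : R) : (-1) ^+ m * a * ((-1) ^+ m * b) = a * b.
Proof.
by rewrite mulrACA -expr2 sqrr_sign mul1r.
Qed.

Lemma norm_sign_mul (m : nat) (a : R) : `|(-1) ^+ m * a| = `|a|.
Proof. by rewrite normrM normrX normrN1 expr1n mul1r. Qed.

Lemma sqr_kappa_le (a : R) : (kappa * a) ^+ 2 <= a ^+ 2.
Proof.
by rewrite exprMn expr2 kappa_sqr; have := sqr_ge0 a; lra.
Qed.

(** [coef_p C j] and [coef_a C j] are the values of phi1 and phi2 at k^2 with k = j + 1, as real
    numbers: odd j means even k, and the frequency indices are k / 2 and (k - 1) / 2 = [j./2]. *)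
Definition coef_p C (j : nat) : R :=
  if odd j then kappa * cosC (pi * (j.+1)./2%:R) C else 0.

Definition coef_a C (j : nat) : R :=
  if odd j then 0 else kappa * cosC (pi * ((j./2)%:R + 2^-1)) C.

Lemma coef_p_sqr_sum C n : sqI C ->
  \sum_(j < n) coef_p C j ^+ 2 <= intI (fun x => C x ^+ 2).
Proof.
move=> sC; have Ci := integrableI_sq sC.
apply: le_trans (Bessel_cosI n sC); apply: ler_sum => j _; rewrite /coef_p.
case: ifPn => [oj|_]; last by rewrite expr0n sqr_ge0.
rewrite -[X in cosI X](@even_halfK j.+1) ?oddS ?oj// intI_cosI_even//.
rewrite [leRHS]exprMn sqrr_sign mul1r.
exact: sqr_kappa_le.
Qed.

(** The half-integer cosine coefficients of C are, up to sign, coefficients against the sines of odd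
    index, so here Bessel's inequality for sines applies. *)
Lemma coef_a_sqr_sum C n : sqI C ->
  \sum_(j < n) coef_a C j ^+ 2 <= intI (fun x => C x ^+ 2).
Proof.
move=> sC; have Ci := integrableI_sq sC.
apply: le_trans (Bessel_sinI n sC); apply: ler_sum => j _; rewrite /coef_a.
case: ifPn => [_|oj]; first by rewrite expr0n sqr_ge0.
rewrite -[in X in _ <= X](even_halfK oj) intI_sinI_odd// [leRHS]exprMn sqrr_sign mul1r.
exact: sqr_kappa_le.
Qed.

(** * Terms of opposite frequencies and their sums *)

Section Terms.
Variables (C : R -> R) (u : R -> R[i]).
Hypothesis Ci : integrableI C.
Hypothesis C_even : {ae mu, forall x, I x -> C (- x) = C x}.
Hypothesis L2u : L2 u.

Let ur : integrableI (fun x => Re (u x)).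
Proof. by have /L2P[/integrableI_sq] := L2u. Qed.

Let ui : integrableI (fun x => Im (u x)).
Proof. by have /L2P[_ /integrableI_sq] := L2u. Qed.

Definition odd_term r x : R[i] :=
  inner (wave r) (fun x => (C x)%:C) * inner (wave r) (P_odd u) * wave r x.

Definition even_term r x : R[i] :=
  inner (wave r) (fun x => (C x)%:C) * inner (wave r) (P_even u) * wave r x.

Lemma odd_termE r x : odd_term r x = (kappa * cosC r C)%:C *
  ((kappa * sinC r (fun x => Im (u x))) +i* (- (kappa * sinC r (fun x => Re (u x))))) *
  wave r x.
Proof. by rewrite /odd_term inner_wave_even// inner_wave_P_odd. Qed.

Lemma even_termE r x : even_term r x = (kappa * cosC r C)%:C *
  ((kappa * cosC r (fun x => Re (u x))) +i* (kappa * cosC r (fun x => Im (u x)))) *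
  wave r x.
Proof. by rewrite /even_term inner_wave_even// inner_wave_P_even. Qed.

Lemma odd_term0 x : odd_term 0 x = 0.
Proof.
have s0 f : sinC 0 f = 0.
  by rewrite -[RHS]intI0; apply: eq_intI => y; rewrite mul0r sin0 mul0r.
by rewrite odd_termE !s0 mulr0 oppr0 -[_ +i* _]/(0 : R[i]) mulr0 mul0r.
Qed.

Lemma odd_term_bound r x : bounded_term (odd_term r x)
  (`|kappa * cosC r C| *
   (`|sinC r (fun x => Re (u x))| + `|sinC r (fun x => Im (u x))|)).
Proof.
rewrite odd_termE; split.
  by rewrite Re_odd_term [(`|sinC _ _| + _)]addrC trig_bound ?sin_max ?cos_max.
rewrite Im_odd_term [(`|sinC _ _| + _)]addrC -mulrN trig_bound ?sin_max//.
by rewrite normrN cos_max.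
Qed.

Lemma even_term_bound r x : bounded_term (even_term r x)
  (`|kappa * cosC r C| *
   (`|cosC r (fun x => Re (u x))| + `|cosC r (fun x => Im (u x))|)).
Proof.
rewrite even_termE; split.
  by rewrite Re_even_term -mulrN trig_bound ?cos_max// normrN sin_max.
by rewrite Im_even_term trig_bound ?sin_max ?cos_max.
Qed.

Lemma odd_term_bound_opp r x : bounded_term (odd_term (- r) x)
  (`|kappa * cosC r C| *
   (`|sinC r (fun x => Re (u x))| + `|sinC r (fun x => Im (u x))|)).
Proof.
by have := odd_term_bound (- r) x; rewrite cosC_oppr !sinC_opp// !normrN.
Qed.

Lemma even_term_bound_opp r x : bounded_term (even_term (- r) x)
  (`|kappa * cosC r C| *
   (`|cosC r (fun x => Re (u x))| + `|cosC r (fun x => Im (u x))|)).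
Proof. by have := even_term_bound (- r) x; rewrite !cosC_oppr. Qed.

(** Under r to -r the sine coefficients of u change sign and that of C does not; the parts in cos(r
    x) cancel and those in sin(r x) double. *)
Lemma odd_term_fold r x : odd_term r x + odd_term (- r) x =
  (kappa * cosC r C * sinC r (fun x => Re (u x)) * sin (r * x)) +i*
  (kappa * cosC r C * sinC r (fun x => Im (u x)) * sin (r * x)).
Proof.
rewrite !odd_termE cosC_oppr !sinC_opp//; apply: complex_ext.
  by rewrite ReD !Re_odd_term (mulNr r x) cosN sinN /=; field.
by rewrite ImD !Im_odd_term (mulNr r x) cosN sinN /=; field.
Qed.

(** All coefficients are now even in r, so the parts in sin(r x) cancel and those in cos(r x)
    double. *)
Lemma even_term_fold r x : even_term r x + even_term (- r) x =
  (kappa * cosC r C * cosC r (fun x => Re (u x)) * cos (r * x)) +i*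
  (kappa * cosC r C * cosC r (fun x => Im (u x)) * cos (r * x)).
Proof.
rewrite !even_termE !cosC_oppr; apply: complex_ext.
  by rewrite ReD !Re_even_term (mulNr r x) cosN sinN /=; field.
by rewrite ImD !Im_even_term (mulNr r x) cosN sinN /=; field.
Qed.

Lemma sine_term_eq0 (t : nat -> R) j x : t j = 0 -> sine_term t u j x = 0.
Proof. by move=> tj; rewrite /sine_term tj mul0r mul0r. Qed.

Lemma sine_term_p (m : nat) x (r := pi * m.+1%:R) :
  sine_term (coef_p C) u m.*2.+1 x = odd_term r x + odd_term (- r) x.
Proof.
rewrite odd_term_fold; apply: complex_ext.
  rewrite Re_sine_term /coef_p /= odd_double /= -doubleS doubleK.
  by rewrite intI_sinI_even// sinI_even -mulrA sign_sqr mulrA.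
rewrite Im_sine_term /coef_p /= odd_double /= -doubleS doubleK.
by rewrite intI_sinI_even// sinI_even -mulrA sign_sqr mulrA.
Qed.

Lemma sine_term_a (m : nat) x (r := pi * (m%:R + 2^-1)) :
  sine_term (coef_a C) u m.*2 x = even_term r x + even_term (- r) x.
Proof.
rewrite even_term_fold; apply: complex_ext.
  rewrite Re_sine_term /coef_a odd_double doubleK.
  by rewrite intI_sinI_odd// sinI_odd -mulrA sign_sqr mulrA.
rewrite Im_sine_term /coef_a odd_double doubleK.
by rewrite intI_sinI_odd// sinI_odd -mulrA sign_sqr mulrA.
Qed.

Lemma sine_weight_p (m : nat) (r := pi * m.+1%:R) :
  sine_weight (coef_p C) u m.*2.+1 = `|kappa * cosC r C| *
   (`|sinC r (fun x => Re (u x))| + `|sinC r (fun x => Im (u x))|).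
Proof.
rewrite /sine_weight /coef_p /= odd_double /= -doubleS doubleK.
by rewrite !intI_sinI_even// !norm_sign_mul.
Qed.

Lemma sine_weight_a (m : nat) (r := pi * (m%:R + 2^-1)) :
  sine_weight (coef_a C) u m.*2 = `|kappa * cosC r C| *
   (`|cosC r (fun x => Re (u x))| + `|cosC r (fun x => Im (u x))|).
Proof.
rewrite /sine_weight /coef_a odd_double doubleK.
by rewrite !intI_sinI_odd// !norm_sign_mul.
Qed.

Lemma bounded_termW z (a b : R) : bounded_term z a -> a <= b -> bounded_term z b.
Proof. by move=> [ra ia] ab; split; [exact: le_trans ra ab|exact: le_trans ia ab]. Qed.

End Terms.

End Coefficients.

Theorem mainTheorem16 (R : realType) (C : R -> R)
  (C_L2 : L2 (fun x => (C x)%:C))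
  (C_even : {ae @lebesgue_measure R, forall x, Iset x -> C (- x) = C x})
  (phi1 phi2 : R -> R[i])
  (phi1E : forall k : nat, (0 < k)%N ->
     phi1 (k%:R ^+ 2) =
     if odd k then 0 else inner (ep (k./2)%:Z) (fun x => (C x)%:C))
  (phi2E : forall k : nat, (0 < k)%N ->
     phi2 (k%:R ^+ 2) =
     if odd k then inner (ea (k.-1./2)%:Z) (fun x => (C x)%:C) else 0) :
  [/\ bounded_on sigma_A_D phi1,
      bounded_on sigma_A_D phi2,
      op_eq (fun h => conv_p (fun x => (C x)%:C) (P_odd h)) (phi_A_D phi1) &
      op_eq (fun h => conv_a (fun x => (C x)%:C) (P_even h)) (phi_A_D phi2)].
Proof.
have sC : sqI C by exact/L2_real.
have Ci := integrableI_sq sC.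
have phi1_coef (j : nat) : phi1 (j.+1%:R ^+ 2) = (coef_p C j)%:C.
  rewrite phi1E// /coef_p oddS; case: (odd j) => //=.
  by rewrite ep_wave inner_wave_even.
have phi2_coef (j : nat) : phi2 (j.+1%:R ^+ 2) = (coef_a C j)%:C.
  rewrite phi2E// /coef_a oddS; case: (odd j) => //=.
  by rewrite ea_wave inner_wave_even.
have sum1 n := coef_p_sqr_sum n sC.
have sum2 n := coef_a_sqr_sum n sC.
split.
- exact: (bounded_on_sigma phi1_coef sum1).
- exact: (bounded_on_sigma phi2_coef sum2).
- apply: (op_eq_fold (b := 1) phi1_coef sum1).
    by move=> k; rewrite ep_wave; exact: cmeas_wave.
  move=> u L2u f; split.
  (* The one unpaired index is k = 0: the constant mode, to which an odd function is orthogonal. *)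
  + case=> // x _; rewrite /f ep_wave mulr0.
    exact: (odd_term0 Ci C_even L2u).
  + move=> m x; rewrite /f ep_NegzE ep_wave.
    (* Index 2m belongs to the eigenvalue (2m + 1)^2, where phi1 vanishes. *)
    rewrite (sine_term_eq0 u x) ?add0r; last by rewrite /coef_p odd_double.
    by rewrite (sine_term_p Ci C_even L2u).
  + move=> m k x kE.
    apply: (@bounded_termW _ _ (sine_weight (coef_p C) u m.*2.+1)); last first.
      by rewrite lerDr sine_weight_ge0.
    rewrite sine_weight_p//; case: kE => ->; rewrite /f.
      by rewrite ep_wave; exact: (odd_term_bound Ci C_even L2u).
    by rewrite ep_NegzE; exact: (odd_term_bound_opp Ci C_even L2u).
- apply: (op_eq_fold (b := 0) phi2_coef sum2).
    by move=> k; rewrite ea_wave; exact: cmeas_wave.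
  move=> u L2u f; split.
  + by [].
  + move=> m x; rewrite /f ea_NegzE ea_wave.
    (* Index 2m + 1 belongs to the eigenvalue (2m + 2)^2, where phi2 vanishes. *)
    rewrite (sine_term_eq0 u x (j := m.*2.+1)) ?addr0; last first.
      by rewrite /coef_a /= odd_double.
    by rewrite (sine_term_a Ci C_even L2u).
  + move=> m k x kE.
    apply: (@bounded_termW _ _ (sine_weight (coef_a C) u m.*2)); last first.
      by rewrite lerDl sine_weight_ge0.
    rewrite sine_weight_a//; case: kE => ->; rewrite /f.
      by rewrite ea_wave; exact: (even_term_bound Ci C_even L2u).
    by rewrite ea_NegzE; exact: (even_term_bound_opp Ci C_even L2u).
Qed.
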